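(* For every $\rho\in(\frac12,1)$ and $\varepsilon\in(0,1)$ there exists $C_{\varepsilon,\rho}>0$ such that, for every sequence of integers $K(N)$ with $N/2<K(N)\le N$ for all $N$ and $\lim_{N\to\infty}K(N)/N=\rho$, $$\limsup_{N\to\infty}\frac{\tau^{\mathrm{FEP}}_{N,K(N)}(\varepsilon)}{N^2\log N}\le C_{\varepsilon,\rho},$$ where $\tau^{\mathrm{FEP}}_{N,K}(\varepsilon)$ is the $\varepsilon$-mixing time of the facilitated exclusion process on $\mathbb{T}_N$ with $K$ particles.
   Context: For $N\ge1$, $\mathbb{T}_N=\{1,\dots,N\}$ is the periodic ring (indices mod $N$) and $\Sigma_N=\{0,1\}^{\mathbb{T}_N}$, $|\eta|=\sum_x\eta_x$. The facilitated exclusion process (FEP) is the continuous-time Markov process on $\Sigma_N$ with generator $\mathscr{L}_Nf(\eta)=\sum_{x\in\mathbb{T}_N}c_{x,x+1}(\eta)\{f(\eta^{x,x+1})-f(\eta)\}$, $c_{x,x+1}(\eta)=\eta_{x-1}\eta_x(1-\eta_{x+1})+(1-\eta_x)\eta_{x+1}\eta_{x+2}$, where $\eta^{x,x+1}$ is $\eta$ with the values at $x$ and $x+1$ exchanged; $\mathbb{P}^N_\eta$ is its law from $\eta$. The number of particles is conserved. For $K>N/2$, the FEP with $K$ particles eventually enters the ergodic component $\{\eta:|\eta|=K,\ (1-\eta_x)(1-\eta_{x+1})=0\ \forall x\}$, and its invariant law $\mu_{N,K}$ is the uniform distribution on that set. With $d_{\mathrm{TV}}$ the total variation distance, $\tau^{\mathrm{FEP}}_{N,K}(\varepsilon)=\inf\{t\ge0:\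 \sup_{\eta\in\Sigma_N,|\eta|=K}d_{\mathrm{TV}}(\mathbb{P}^N_\eta(\eta(t)\in\cdot),\mu_{N,K})\le\varepsilon\}$. *)

(* Defs.v *)
From mathcomp Require Import all_boot all_order all_algebra all_fingroup.
From mathcomp Require Import all_classical all_reals all_analysis.

Set Implicit Arguments.
Unset Strict Implicit.
Unset Printing Implicit Defensive.

Import Order.TTheory GRing.Theory Num.Theory.
Import numFieldNormedType.Exports.

Local Open Scope ring_scope.

(* The periodic ring with N sites is 'I_N, on which ordS and ord_pred are the
   successor and the predecessor modulo N. *)
Definition config (N : nat) := {ffun 'I_N -> bool}.

Definition nparticles (N : nat) (eta : config N) : nat :=
  (\sum_(x < N) eta x)%N.

Definition exchange (N : nat) (x : 'I_N) (eta : config N) : config N :=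
  [ffun z => eta (tperm x (ordS x) z)].

Definition fep_rate (R : realType) (N : nat) (x : 'I_N) (eta : config N) : R :=
  (eta (ord_pred x))%:R * (eta x)%:R * (1 - (eta (ordS x))%:R)
  + (1 - (eta x)%:R) * (eta (ordS x))%:R * (eta (ordS (ordS x)))%:R.

Definition fep_generator (R : realType) (N : nat) (f : config N -> R)
    (eta : config N) : R :=
  \sum_(x < N) fep_rate R x eta * (f (exchange x eta) - f eta).

(* exp (t L) f = \sum_k (t ^ k / k!) L ^ k f, which is eta |-> E_eta[f(eta(t))].
   The series converges since L is a bounded operator (config N is finite). *)
Definition fep_semigroup (R : realType) (N : nat) (t : R) (f : config N -> R)
    (eta : config N) : R :=
  limn (series (fun k : nat =>
    t ^+ k / k`!%:R * iter k (@fep_generator R N) f eta)).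

Definition fep_law (R : realType) (N : nat) (eta : config N) (t : R)
    (A : {set config N}) : R :=
  fep_semigroup t (fun xi => (xi \in A)%:R) eta.

(* The subtractions are in nat, and never truncate as eta x is 0 or 1. *)
Definition ergodic_component (N K : nat) : {set config N} :=
  [set eta : config N | (nparticles eta == K) &&
    [forall x : 'I_N, (1 - eta x) * (1 - eta (ordS x)) == 0]%N].

Definition fep_invariant (R : realType) (N K : nat) (A : {set config N}) : R :=
  #|A :&: ergodic_component N K|%:R / #|ergodic_component N K|%:R.

(* Laws on the finite set T are given by their values on the subsets of T. *)
Definition dTV (R : realType) (T : finType) (P Q : {set T} -> R) : R :=
  \big[Num.max/0]_(A : {set T}) `|P A - Q A|.

Definition fep_distance (R : realType) (N K : nat) (t : R) : R :=
  \big[Num.max/0]_(eta : config N | nparticles eta == K)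
    dTV (fep_law eta t) (@fep_invariant R N K).

(* Extended-real valued, so that the infimum of the empty set is +oo. *)
Definition fep_mixing_time (R : realType) (N K : nat) (eps : R) : \bar R :=
  ereal_inf [set t%:E | t in [set t : R | 0 <= t /\ fep_distance N K t <= eps]].

(* Main.v *)
Require Import Defs.
From mathcomp Require Import all_boot all_order all_algebra all_fingroup.
From mathcomp Require Import all_classical all_reals all_analysis.
From mathcomp Require Import zify ring lra.

(** Label the particles in cyclic order and unwrap the ring: a configuration with
K particles is given by their positions x_j, with j ranging over the integers,
where x_(j + K) = x_j + N and all gaps x_(j + 1) - x_j are at least 1. Such an x
is a [labelling]; relabelling j -> j + 1, or adding N, does not change the
configuration [config_of x]. The ergodic component corresponds to the [tight]
labellings, whose gaps are 1 or 2.

On tight labellings the dynamics is linear: at rate 1, each particle m is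
moved from x_m to x_(m-1) + x_(m+1) - x_m, that is, its two adjacent gaps are
exchanged ([generator_tight]). This is the symmetric exclusion process seen
through its height function. Compare two labellings x <= y <= x + 1 and let
d be the number of labels in a period where they differ. Moving both
labellings with the same label changes d by the sign of a discrete Laplacian of
y - x, so that d is a martingale with non zero jumps, and a strictly concave
function [cost d] = d (b - d) decreases on average. Hence the Lipschitz
constant of a function with respect to this cost decays
([shifted_generator_lipschitz]). The delicate case is d = K, where y = x + 1 is
the configuration rotated by one site and the pair is stuck. But x is also the
relabelling j -> x_(j + 1), which lies above x + 1 and is reached from it by
N - K single moves ([push_towards], [cost_lipschitz_close]). Each move costs
[cost 1], and since N - K < K the slope b can be chosen so that
(N - K) [cost 1] <= [cost K]. This is where the density above 1/2 enters, and
it gives a contraction rate of order 1/N^2 with an absolute position on the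
ring, not only up to rotations.

Before the ergodic component is reached, some gaps are at least 3, and such
wide gaps never appear anew. Weigh each wide gap by a constant minus a linear
statistic [moment] of the positions, whose drift is twice the number of
gaps equal to 1 as long as that gap is wide. There are at least 2 K - N such
gaps, so the resulting [potential] decreases at a rate of order 1/N^2
([potential_drift]).

Both estimates bound the operator 2 K + L applied to a mean zero function
([shifted_generator_controlled]), and so all its iterates. Writing
exp (t L) = exp (- 2 K t) exp (t (2 K + L)) turns this into the bound
poly(N) exp (- c t / N^2) on the total variation distance ([fep_law_bound]);
with t of order N^2 log N it tends to 0. The constant obtained does not depend
on the precision. *)

Set Implicit Arguments.
Unset Strict Implicit.
Unset Printing Implicit Defensive.

Import Order.TTheory GRing.Theory Num.Theory.
Import numFieldNormedType.Exports.

Local Open Scope ring_scope.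

(** * Periodic integer sequences *)

Section PeriodicSequences.
Variable K : nat.

Definition periodic (w : int -> int) := forall j, w (j + K%:Z) = w j.

(** Stated with a drift a, to serve both periodic sequences (a = 0) and
    labellings (a = N). *)
Lemma quasi_periodic (a : int) (x : int -> int) :
  (forall j, x (j + K%:Z) = x j + a) ->
  forall j q : int, x (j + q * K%:Z) = x j + q * a.
Proof.
move=> xa j; elim=> [|q ih|q ih]; first by rewrite !mul0r !addr0.
- by rewrite intS !mulrDl !mul1r addrCA addrC xa ih; ring.
- have := xa (j + - (q.+1)%:Z * K%:Z); rewrite -addrA.
  have -> : - (q.+1)%:Z * K%:Z + K%:Z = (- q%:Z) * K%:Z by rewrite intS; ring.
  by rewrite ih => e; apply: (addIr a); rewrite -e intS; ring.
Qed.

Lemma periodicM (w : int -> int) (j q : int) :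
  periodic w -> w (j + q * K%:Z) = w j.
Proof.
move=> pw; rewrite (@quasi_periodic 0) ?mulr0 ?addr0 // => i.
by rewrite pw addr0.
Qed.

Lemma telescope_ord (n : nat) (w : int -> int) (j : int) :
  \sum_(d < n) (w (j + d%:Z + 1) - w (j + d%:Z)) = w (j + n%:Z) - w j.
Proof.
elim: n => [|n ih]; first by rewrite big_ord0 addr0 subrr.
rewrite big_ord_recr /= ih.
have -> : j + n.+1%:Z = j + n%:Z + 1 by lia.
by ring.
Qed.

Lemma sum_shift (w : int -> int) : periodic w ->
  \sum_(j < K) w (j%:Z + 1) = \sum_(j < K) w j.
Proof.
move=> pw; apply/eqP; rewrite -subr_eq0 -sumrB.
have := telescope_ord K w 0; rewrite pw subrr => h.
by apply/eqP; rewrite -[RHS]h; apply: eq_bigr => d _; rewrite add0r.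
Qed.

Lemma sum_shiftN (w : int -> int) : periodic w ->
  \sum_(j < K) w (j%:Z - 1) = \sum_(j < K) w j.
Proof.
move=> pw; rewrite -(@sum_shift (fun j => w (j - 1))).
  by apply: eq_bigr => j _; rewrite addrK.
by move=> j; rewrite addrAC pw.
Qed.

Hypothesis K_gt1 : (1 < K)%N.

(** The indicator of the residue class of j modulo K: adding a multiple of it
    to a labelling moves the single particle j on the ring. *)
Definition delta (j i : int) : int := (K %| i - j)%Z%:R.

Lemma deltaP (j i : int) :
  (exists2 q, i = j + q * K%:Z & delta j i = 1) \/
  ((forall q, i <> j + q * K%:Z) /\ delta j i = 0).
Proof.
rewrite /delta; case: dvdzP => [[q e]|ne]; [left|right].
  by exists q => //; rewrite -e addrC subrK.
by split => // q e; apply: ne; exists q; rewrite e addrC addKr.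
Qed.

Lemma delta_refl (j : int) : delta j j = 1.
Proof. by rewrite /delta subrr dvdz0. Qed.

Lemma delta_sym (j i : int) : delta j i = delta i j.
Proof. by rewrite /delta -opprB !dvdzE abszN. Qed.

Lemma delta_periodic (j : int) : periodic (delta j).
Proof.
move=> i; rewrite /delta; have -> : i + K%:Z - j = (i - j) + K%:Z by ring.
by rewrite rpredDr ?dvdzz.
Qed.

Lemma mulK_eq1 (q : int) : q * K%:Z <> 1.
Proof.
move=> e; have : (K %| 1)%Z by apply/dvdzP; exists q.
by rewrite dvdz1 /= => /eqP; lia.
Qed.

Lemma delta_succ (j i : int) : delta j i = 1 -> delta j (i + 1) = 0.
Proof.
case: (deltaP j i) => [[q -> _ _]|[_ ->]//].
case: (deltaP j (j + q * K%:Z + 1)) => [[r e _]|[]//].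
by case: (@mulK_eq1 (r - q)); rewrite mulrBl; lia.
Qed.

Lemma delta_pred (j i : int) : delta j i = 1 -> delta j (i - 1) = 0.
Proof.
case: (deltaP j (i - 1)) => [[q e h]|[]//].
by have := delta_succ h; rewrite subrK => ->.
Qed.

Lemma delta01 (j i : int) : delta j i = 0 \/ delta j i = 1.
Proof. by case: (deltaP j i) => [[]|[]]; [right|left]. Qed.

Lemma sum_delta (w : int -> int) (i : int) : periodic w ->
  \sum_(m < K) delta m i * w m = w i.
Proof.
move=> pw.
have K0 : K%:Z != 0 by lia.
have m0 : 0 <= (i %% K)%Z by apply: modz_ge0.
have mK : (`|(i %% K)%Z| < K)%N by have := ltz_mod i K0; lia.
have em : (Ordinal mK : nat)%:Z = (i %% K)%Z by rewrite /= gez0_abs.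
have ei := divz_eq i K.
rewrite (bigD1 (Ordinal mK)) //= big1 => [|m nem].
  rewrite gez0_abs // addr0.
  have -> : w (i %% K)%Z = w i by rewrite [in RHS]ei addrC periodicM.
  case: (deltaP (i %% K)%Z i) => [[q _ ->]|[ne _]]; first by rewrite mul1r.
  by case: (ne (i %/ K)%Z); rewrite {1}ei addrC.
case: (deltaP m i) => [[q e _]|[_ ->]]; last by rewrite mul0r.
case/eqP: nem; apply: val_inj => /=.
suff -> : (i %% K)%Z = m by [].
by rewrite e addrC modzMDl modz_small //; have := ltn_ord m; lia.
Qed.

Lemma sum_delta1 (j : int) : \sum_(i < K) delta j i = 1.
Proof.
rewrite -[RHS](@sum_delta (fun=> 1) j) //; apply: eq_bigr => i _.
by rewrite mulr1 delta_sym.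
Qed.

Lemma periodic_argmin (w : int -> int) : periodic w ->
  exists j, forall i, w j <= w i.
Proof.
move=> pw; have K0 : (0 < K)%N by lia.
case: (@arg_minP _ _ _ (Ordinal K0) xpredT (fun i : 'I_K => w i)) => // j _ hj.
exists j => i; have Kn : K%:Z != 0 by lia.
have m0 : 0 <= (i %% K)%Z by apply: modz_ge0.
have mK : (`|(i %% K)%Z| < K)%N by have := ltz_mod i Kn; lia.
have := hj (Ordinal mK) isT; rewrite /= gez0_abs //.
by rewrite [in w i](divz_eq i K) [_ * _ + _]addrC periodicM.
Qed.

Lemma periodic_sum_ge (w : int -> int) : periodic w -> (forall j, 0 <= w j) ->
  forall j, w j <= \sum_(i < K) w i.
Proof.
move=> pw w0 j; rewrite -[X in X <= _](@sum_delta w j) //.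
apply: ler_sum => m _; case: (delta01 m j) => ->; rewrite ?mul0r ?mul1r //.
Qed.

End PeriodicSequences.

(** * Labellings of the particles and the coupling on the ergodic component *)

Section Labellings.
Variables K N : nat.

Definition labelling (x : int -> int) :=
  (forall j : int, x (j + K%:Z) = x j + N%:Z) /\ (forall j : int, x j + 1 <= x (j + 1)).

Definition tight (x : int -> int) :=
  labelling x /\ forall j : int, x (j + 1) <= x j + 2.

Definition push (x : int -> int) (j e : int) : int -> int :=
  fun i => x i + e * delta K j i.

Lemma labellingM x (j : int) (q : int) : labelling x -> x (j + q * K%:Z) = x j + q * N%:Z.
Proof. by case=> xa _; apply: quasi_periodic. Qed.

Lemma labelling_ge x (i : int) (d : nat) : labelling x -> x i + d%:Z <= x (i + d%:Z).
Proof.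
case=> _ x1; elim: d => [|d ih]; first by rewrite !addr0.
have := x1 (i + d%:Z); have -> : i + d.+1%:Z = i + d%:Z + 1 by lia.
by lia.
Qed.

Lemma labelling_lt x (i j : int) : labelling x -> i < j -> x i < x j.
Proof.
move=> lx ij; have := labelling_ge i `|j - i|%N lx.
have -> : i + `|j - i|%N%:Z = j by lia.
by lia.
Qed.

Lemma labelling_le x (i j : int) : labelling x -> i <= j -> x i <= x j.
Proof.
move=> lx; rewrite le_eqVlt => /orP[/eqP->//|/(labelling_lt lx)/ltW //].
Qed.

Lemma labelling_inj x : labelling x -> injective x.
Proof.
move=> lx i j e; case: (ltgtP i j) => // /(labelling_lt lx); rewrite e; lia.
Qed.

Lemma delta_labelling x (j i : int) : labelling x ->
  (exists q, [/\ delta K j i = 1, x i = x j + q * N%:Z,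
     x (i + 1) = x (j + 1) + q * N%:Z & x (i - 1) = x (j - 1) + q * N%:Z]) \/
  delta K j i = 0.
Proof.
move=> lx; case: (deltaP K j i) => [[q -> d1]|[_ ->]]; [left|by right].
exists q; split => //; first exact: labellingM.
  by rewrite addrAC labellingM.
by rewrite addrAC labellingM.
Qed.

Lemma tight_gap x : tight x -> forall j : int,
  x j + 1 <= x (j + 1) <= x j + 2 /\ x (j - 1) + 1 <= x j <= x (j - 1) + 2.
Proof.
move=> [[_ x1] x2] j; have := x1 (j - 1); have := x2 (j - 1).
by rewrite subrK; have := x1 j; have := x2 j; lia.
Qed.

Lemma push0 x (m : int) : push x m 0 =1 x.
Proof. by move=> i; rewrite /push mul0r addr0. Qed.

Hypothesis K_gt1 : (1 < K)%N.

(** Only the gaps on both sides of particle j change. Each alternative also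
    identifies the old gap at i, since i runs over all labels while j is fixed
    only modulo K. *)
Lemma push_gap x (j : int) (e : int) : labelling x -> forall i : int,
  let g := push x j e (i + 1) - push x j e i in
  [\/ g = x (i + 1) - x i - e /\ x (i + 1) - x i = x (j + 1) - x j,
      g = x (i + 1) - x i + e /\ x (i + 1) - x i = x j - x (j - 1) |
      g = x (i + 1) - x i].
Proof.
move=> lx i /=; rewrite /push.
case: (delta_labelling j i lx) => [[q [d1 e0 e1 _]]|d0].
  by constructor 1; rewrite d1 (delta_succ K_gt1 d1) e0 e1; lia.
case: (delta_labelling j (i + 1) lx) => [[q [d1 e0 _ e1]]|d0'].
  by constructor 2; rewrite d1 d0; rewrite addrK in e1; rewrite e0 e1; lia.
by constructor 3; rewrite d0 d0'; lia.
Qed.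

Lemma push_quasi x j e : labelling x ->
  forall i : int, push x j e (i + K%:Z) = push x j e i + N%:Z.
Proof. by case=> xa _ i; rewrite /push xa delta_periodic; lia. Qed.

Lemma push_labelling x (j : int) (e : int) : labelling x ->
  x j + e + 1 <= x (j + 1) -> x (j - 1) + 1 <= x j + e -> labelling (push x j e).
Proof.
move=> lx h1 h2; split; first exact: push_quasi.
move=> i; have /= := push_gap j e lx i; case: lx => _ /(_ i).
by move=> ? []; lia.
Qed.

Lemma push_tight x (j : int) (e : int) : tight x ->
  x j + e + 1 <= x (j + 1) <= x j + e + 2 ->
  x (j - 1) + 1 <= x j + e <= x (j - 1) + 2 -> tight (push x j e).
Proof.
move=> [lx tx] h1 h2; split; first by apply: push_labelling => //; lia.
move=> i; have /= := push_gap j e lx i; have := tx i.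
by move=> ? []; lia.
Qed.

(** Reflecting particle m between its neighbours exchanges its two gaps. On
    tight labellings this is a jump allowed by the dynamics, or nothing when
    the two gaps are equal. *)
Definition swap_gaps (x : int -> int) (m : int) : int -> int :=
  push x m (x (m - 1) + x (m + 1) - 2 * x m).

Lemma swap_gaps_tight x (m : int) : tight x -> tight (swap_gaps x m).
Proof.
by move=> tx; have [? ?] := tight_gap tx m; apply: push_tight => //; lia.
Qed.

Definition displacement (x y : int -> int) : int := \sum_(j < K) (y j - x j).

Lemma displacement_push x y (m : int) (a b : int) :
  displacement (push x m a) (push y m b) = displacement x y + b - a.
Proof.
rewrite /displacement /push.
under eq_bigr => i _ do
  have -> : y i + b * delta K m i - (x i + a * delta K m i) =
            (y i - x i) + (b - a) * delta K m i by ring.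
by rewrite big_split /= -mulr_sumr sum_delta1 // mulr1 addrA.
Qed.

Lemma displacement_pushr x y (m : int) (b : int) :
  displacement x (push y m b) = displacement x y + b.
Proof.
rewrite -[RHS]subr0 -(displacement_push x y m 0 b) /displacement.
by apply: eq_bigr => i _; rewrite push0.
Qed.

Lemma displacement_pushl x y (m : int) (a : int) :
  displacement (push x m a) y = displacement x y - a.
Proof.
rewrite -[displacement x y]addr0 -(displacement_push x y m a 0) /displacement.
by apply: eq_bigr => i _; rewrite push0.
Qed.

(** The pairs on which the coupling acts: the order is preserved, and so is
    the bound 1 on the difference. *)
Definition close_pair (x y : int -> int) :=
  [/\ tight x, tight y & forall j : int, x j <= y j <= x j + 1].

Lemma diff_periodic x y : labelling x -> labelling y -> periodic K (fun j => y j - x j).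
Proof. by move=> [xa _] [ya _] j; rewrite xa ya; lia. Qed.

Lemma displacement_ge x y : labelling x -> labelling y -> (forall j : int, x j <= y j) ->
  forall j : int, y j - x j <= displacement x y.
Proof.
move=> lx ly xy; apply: periodic_sum_ge => //; first exact: diff_periodic.
by move=> j; rewrite subr_ge0.
Qed.

Lemma close_pair_displacement x y : close_pair x y ->
  0 <= displacement x y <= K%:Z.
Proof.
move=> [_ _ xy]; apply/andP; split.
  by apply: sumr_ge0 => j _; have := xy j; lia.
have -> : K%:Z = \sum_(j < K) 1 by rewrite sumr_const card_ord natz.
by apply: ler_sum => j _; have := xy j; lia.
Qed.

Lemma displacement0 x y : close_pair x y -> displacement x y = 0 -> x =1 y.
Proof.
move=> [tx ty xy] S0 j.
have := @displacement_ge x y tx.1 ty.1 _ j; rewrite S0.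
by have := xy j => ? H; have := H (fun i => proj1 (andP (xy i))); lia.
Qed.

(** At the maximal displacement the second configuration is the first one
    rotated by one site. *)
Lemma displacementK x y : close_pair x y -> displacement x y = K%:Z ->
  forall j : int, y j = x j + 1.
Proof.
move=> [tx ty xy] SK j.
have p : periodic K (fun j => x j + 1 - y j).
  by move=> i; have := diff_periodic tx.1 ty.1 i; lia.
have := periodic_sum_ge K_gt1 p (fun i => _) j.
have -> : \sum_(i < K) (x i + 1 - y i) = 0.
  apply: (@addrI _ (displacement x y)); rewrite addr0 /displacement -big_split /=.
  rewrite [RHS]SK (eq_bigr (fun=> 1)) => [|i _]; last by ring.
  by rewrite sumr_const card_ord natz.
move=> H; have := xy j; have : x j + 1 - y j <= 0; last by lia.
by apply: H => i; have := xy i; lia.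
Qed.

Definition laplacian (v : int -> int) (m : int) : int :=
  v (m - 1) + v (m + 1) - 2 * v m.

(** The reflection is affine, so it acts on the difference v = y - x by adding
    the Laplacian w of v at m. If |w| <= 1 the new difference still takes the
    values 0 and 1, and both labellings can move together. If |w| = 2 they
    would cross; moving only one of them instead gives two close pairs, one
    for each choice, whose displacement has changed by w / 2. *)
Lemma close_pair_swap_gaps x y (m : int) : close_pair x y ->
  let w := laplacian (fun j => y j - x j) m in
  if `|w| <= 1 then
    close_pair (swap_gaps x m) (swap_gaps y m) /\
    displacement (swap_gaps x m) (swap_gaps y m) = displacement x y + w
  else
    [/\ close_pair x (swap_gaps y m), close_pair (swap_gaps x m) y,
        2 * displacement x (swap_gaps y m) = 2 * displacement x y + w &
        2 * displacement (swap_gaps x m) y = 2 * displacement x y + w].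
Proof.
move=> [tx ty xy] w.
have ew : y (m - 1) + y (m + 1) - 2 * y m -
          (x (m - 1) + x (m + 1) - 2 * x m) = w by rewrite /w /laplacian; lia.
have [gx gx'] := tight_gap tx m; have [gy gy'] := tight_gap ty m.
have b0 := xy m; have b1 := xy (m + 1); have b2 := xy (m - 1).
have sx := swap_gaps_tight m tx; have sy := swap_gaps_tight m ty.
have cp (a b : int) : 0 <= y m - x m + (b - a) <= 1 ->
    forall j : int, push x m a j <= push y m b j <= push x m a j + 1.
  move=> h j; rewrite /push; have := xy j.
  case: (deltaP K m j) => [[q ej ->]|[_ ->]]; last by lia.
  by rewrite ej (labellingM _ _ tx.1) (labellingM _ _ ty.1); lia.
case: ifP => hw.
  split; last by rewrite displacement_push -ew; ring.
  by split => //; apply: cp; lia.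
have s1 j : x j <= swap_gaps y m j <= x j + 1.
  by have := @cp 0 _ _ j; rewrite push0; apply; lia.
have s2 j : swap_gaps x m j <= y j <= swap_gaps x m j + 1.
  by have := @cp _ 0 _ j; rewrite push0; apply; lia.
split => //; rewrite ?displacement_pushr ?displacement_pushl; lia.
Qed.

Lemma laplacian_sum0 x y : labelling x -> labelling y ->
  \sum_(m < K) laplacian (fun j => y j - x j) m = 0.
Proof.
move=> lx ly; have p := diff_periodic lx ly.
rewrite /laplacian sumrB big_split /=.
rewrite (sum_shift p) (sum_shiftN p) -mulr_sumr; ring.
Qed.

(** A 0-1 valued periodic sequence that is harmonic at every point is
    constant, hence has displacement 0 or K. *)
Lemma laplacian_sum_ge1 x y : close_pair x y -> 0 < displacement x y < K%:Z ->
  1 <= \sum_(m < K) `|laplacian (fun j => y j - x j) m|.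
Proof.
move=> pxy; have [tx ty xy] := pxy => S.
set v := fun j => y j - x j.
have pv : periodic K v := diff_periodic tx.1 ty.1.
have pl : periodic K (fun m => `|laplacian v m|).
  move=> m; rewrite /laplacian pv.
  have -> : m + K%:Z - 1 = m - 1 + K%:Z by ring.
  by rewrite pv (_ : m + K%:Z + 1 = m + 1 + K%:Z) ?pv //; ring.
rewrite leNgt; apply/negP => h.
have l0 m : laplacian v m = 0.
  have /= := le_lt_trans (periodic_sum_ge K_gt1 pl (fun i => normr_ge0 _) m) h.
  by lia.
have vn (n : nat) : v n%:Z = v 0.
  elim: n => [//|n ih]; have := l0 n%:Z; rewrite /laplacian.
  have -> : n.+1%:Z = n%:Z + 1 by lia.
  have := xy n%:Z; have := xy (n%:Z + 1); have := xy (n%:Z - 1).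
  by move: ih; rewrite /v; lia.
have : displacement x y = K%:Z * v 0.
  rewrite /displacement (eq_bigr (fun=> v 0)) => [|i _]; last exact: vn.
  by rewrite sumr_const card_ord -mulr_natl natz.
have [->|->] : v 0 = 0 \/ v 0 = 1 by have := xy 0; rewrite /v; lia.
  by rewrite mulr0; lia.
by rewrite mulr1; lia.
Qed.

(** Minimise K x_j - N j - B (y_j - x_j) over j. The first two terms favour
    the convex positions of x: as the average gap N / K lies strictly between
    1 and 2, they force gap 1 on the left and gap 2 on the right of a
    minimiser. The last term, which only strengthens this, forces y_j to be
    above x_j. *)
Lemma push_towards x y : (K < N)%N -> (N < 2 * K)%N -> tight x -> tight y ->
  (forall j : int, x j <= y j) -> (exists j : int, x j < y j) ->
  exists j : int, [/\ x j < y j, x j = x (j - 1) + 1 & x (j + 1) = x j + 2].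
Proof.
move=> KN N2K tx ty xy [j0 xyj0].
pose q i := K%:Z * x i - N%:Z * i.
have pq : periodic K q by move=> i; rewrite /q tx.1.1; ring.
have [jm hm] := periodic_argmin K_gt1 pq.
(* Large enough for a label with y_j = x_j to lose against j0. *)
pose B := q j0 - q jm + 1.
have B1 : 1 <= B by have := hm j0; rewrite /B; lia.
have pQ : periodic K (fun i => q i - B * (y i - x i)).
  by move=> i; rewrite pq (diff_periodic tx.1 ty.1).
have [j hj] := periodic_argmin K_gt1 pQ.
have [g g'] := tight_gap tx j; have [h h'] := tight_gap ty j.
exists j; split.
- rewrite ltNge; apply/negP => yx; have e : y j = x j by have := xy j; lia.
  have := hj j0; rewrite e subrr mulr0 subr0 => hj0.
  have : B * (y j0 - x j0) >= B * 1 by apply: ler_wpM2l; lia.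
  by have := hm j; rewrite /B in B1 *; lia.
- have := hj (j - 1); rewrite /q => H.
  have [//|e] : x j = x (j - 1) + 1 \/ x j = x (j - 1) + 2 by lia.
  have : 0 <= B * ((y (j - 1) - x (j - 1)) - (y j - x j)).
    by apply: mulr_ge0; lia.
  by rewrite e in H *; nia.
- have := hj (j + 1); rewrite /q => H.
  have [e|//] : x (j + 1) = x j + 1 \/ x (j + 1) = x j + 2 by lia.
  have : 0 <= B * ((y (j + 1) - x (j + 1)) - (y j - x j)).
    by apply: mulr_ge0; lia.
  by rewrite e in H *; nia.
Qed.

End Labellings.

(** * A potential that drains the wide gaps *)

Section Transience.
Variables K N : nat.
Hypothesis K_gt1 : (1 < K)%N.

(** Particle m may jump forward: it is pushed by the particle behind it and
    the next site is empty. *)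
Definition fwd (x : int -> int) (m : int) : bool :=
  (x m == x (m - 1) + 1) && (x m + 2 <= x (m + 1)).

Definition bwd (x : int -> int) (m : int) : bool :=
  (x (m - 1) + 2 <= x m) && (x (m + 1) == x m + 1).

Definition open_gap (x : int -> int) (m : int) : int := (x m + 2 <= x (m + 1))%R%:R.

Definition wide_gap (x : int -> int) (m : int) : bool := x m + 3 <= x (m + 1).

(** A linear statistic centred at particle j, invariant under translations as
    its coefficients sum to 0. The discrete derivative of its coefficients is
    constant except for one jump at j, so its drift isolates whether the gap
    at j is open. *)
Definition moment (x : int -> int) (j : int) : int :=
  \sum_(d < K) (2 * d%:Z + 1 - K%:Z) * x (j + d%:Z + 1).

(** Kept positive on wide gaps by the constant, which is twice the bound on
    the moment. *)
Definition local_potential (x : int -> int) (j : int) : int :=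
  if wide_gap x j then 2 * (K ^ 2 * N)%N%:Z - moment x j else 0.

Definition potential (x : int -> int) : int := \sum_(j < K) local_potential x j.

Lemma push_fwd x (m : int) : labelling K N x -> fwd x m -> labelling K N (push K x m 1).
Proof. by move=> lx; rewrite /fwd => h; apply: push_labelling => //; lia. Qed.

Lemma push_bwd x (m : int) : labelling K N x -> bwd x m ->
  labelling K N (push K x m (- 1)).
Proof. by move=> lx; rewrite /bwd => h; apply: push_labelling => //; lia. Qed.

(** The process is of gradient type: the drift of particle m is a difference
    of a local function. *)
Lemma fwd_bwd x (m : int) : labelling K N x ->
  (fwd x m)%:R - (bwd x m)%:R = open_gap x m - open_gap x (m - 1) :> int.
Proof.
move=> [_ x1]; have := x1 m; have := x1 (m - 1).
rewrite /fwd /bwd /open_gap subrK; lia.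
Qed.

(** A particle only jumps away from a neighbour at distance 1, so a jump can
    only enlarge a gap from 1 to 2. *)
Lemma wide_gap_push x (m j : int) (e : int) : labelling K N x ->
  (e = 1 /\ fwd x m) \/ (e = - 1 /\ bwd x m) ->
  wide_gap (push K x m e) j -> wide_gap x j.
Proof.
move=> lx h; have /= := @push_gap K N K_gt1 x m e lx j.
by rewrite /wide_gap /fwd /bwd in h *; case; lia.
Qed.

Lemma sum_moment_coef (n : nat) :
  \sum_(d < n) (2 * d%:Z + 1 - K%:Z) = n%:Z * (n%:Z - K%:Z).
Proof.
elim: n => [|n ih]; first by rewrite big_ord0 mul0r.
rewrite big_ord_recr /= ih; have -> : n.+1%:Z = n%:Z + 1 by lia.
ring.
Qed.

Lemma moment_bound x (j : int) : labelling K N x ->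
  `|moment x j| <= (K ^ 2 * N)%N%:Z.
Proof.
move=> lx.
have -> : moment x j =
    \sum_(d < K) (2 * d%:Z + 1 - K%:Z) * (x (j + d%:Z + 1) - x j).
  have /(congr1 (fun c => c * x j)) := sum_moment_coef K.
  rewrite subrr mulr0 mul0r => c0; under [RHS]eq_bigr => d _ do rewrite mulrBr.
  by rewrite sumrB -mulr_suml c0 subr0.
apply: le_trans (ler_norm_sum _ _ _) _.
have -> : (K ^ 2 * N)%N%:Z = \sum_(d < K) (K * N)%N%:Z.
  by rewrite sumr_const card_ord; nia.
apply: ler_sum => d _; rewrite normrM PoszM.
have dK := ltn_ord d.
have h1 : x j <= x (j + d%:Z + 1) by apply: (@labelling_le K N) => //; lia.
have h2 : x (j + d%:Z + 1) <= x j + N%:Z.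
  by rewrite -lx.1; apply: (@labelling_le K N) => //; lia.
by apply: ler_pM => //; lia.
Qed.

Lemma moment_push x (m j e : int) :
  moment (push K x m e) j - moment x j =
  e * \sum_(d < K) (2 * d%:Z + 1 - K%:Z) * delta K m (j + d%:Z + 1).
Proof.
rewrite /moment -sumrB mulr_sumr; apply: eq_bigr => d _.
by rewrite /push -mulrBr [_ + e * _]addrC addrK mulrCA.
Qed.

Lemma abel_gap (u : int -> int) (j : int) (n : nat) :
  \sum_(d < n) (2 * d%:Z + 1 - K%:Z) * (u (j + d%:Z + 1) - u (j + d%:Z)) =
  (2 * n%:Z - 1 - K%:Z) * u (j + n%:Z) + (K%:Z + 1) * u j
    - 2 * \sum_(d < n) u (j + d%:Z).
Proof.
elim: n => [|n ih]; first by rewrite !big_ord0 (addr0 j) mulr0 subr0; ring.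
rewrite !big_ord_recr /= ih.
have -> : j + n.+1%:Z = j + n%:Z + 1 by lia.
have -> : n.+1%:Z = n%:Z + 1 by lia.
ring.
Qed.

(** Each gap at least 2 contains a hole, and there are N - K holes in a
    period. *)
Lemma open_gap_sum x (j : int) : labelling K N x ->
  \sum_(d < K) open_gap x (j + d%:Z) <= N%:Z - K%:Z.
Proof.
move=> lx; have := telescope_ord K x j; rewrite lx.1 => e.
have -> : N%:Z - K%:Z = \sum_(d < K) (x (j + d%:Z + 1) - x (j + d%:Z) - 1).
  by rewrite sumrB e sumr_const card_ord natz; ring.
apply: ler_sum => d _; rewrite /open_gap; have := lx.2 (j + d%:Z); lia.
Qed.

Lemma open_gap_periodic x : labelling K N x -> periodic K (open_gap x).
Proof.
by move=> [xa _] j; rewrite /open_gap addrAC !xa addrAC lerD2r.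
Qed.

(** As the gap at j is open, the drift equals 2 (K - u) where u is the number
    of open gaps, at most N - K. *)
Lemma moment_drift x (j : int) : labelling K N x -> wide_gap x j ->
  2 * (2 * K%:Z - N%:Z) <=
  \sum_(m < K) ((fwd x m)%:R - (bwd x m)%:R) *
     \sum_(d < K) (2 * d%:Z + 1 - K%:Z) * delta K m (j + d%:Z + 1).
Proof.
move=> lx g3; have pu := open_gap_periodic lx.
have -> : \sum_(m < K) ((fwd x m)%:R - (bwd x m)%:R) *
     \sum_(d < K) (2 * d%:Z + 1 - K%:Z) * delta K m (j + d%:Z + 1) =
  \sum_(d < K) (2 * d%:Z + 1 - K%:Z) *
     (open_gap x (j + d%:Z + 1) - open_gap x (j + d%:Z)).
  under eq_bigr => m _ do rewrite mulr_sumr.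
  rewrite exchange_big /=; apply: eq_bigr => d _.
  have pw : periodic K (fun m => open_gap x m - open_gap x (m - 1)).
    by move=> m; rewrite pu addrAC pu.
  have /= := sum_delta K_gt1 (j + d%:Z + 1) pw; rewrite addrK => <-.
  rewrite mulr_sumr; apply: eq_bigr => m _.
  by rewrite fwd_bwd //; ring.
rewrite abel_gap pu.
have -> : open_gap x j = 1 by rewrite /open_gap; rewrite /wide_gap in g3; lia.
have := open_gap_sum j lx; lia.
Qed.

Lemma local_potential_bounds x (j : int) : labelling K N x ->
  (K ^ 2 * N)%N%:Z * (wide_gap x j)%:R <= local_potential x j
    <= 3 * (K ^ 2 * N)%N%:Z * (wide_gap x j)%:R.
Proof.
move=> lx; rewrite /local_potential; case: ifP => //= _; have := moment_bound j lx; lia.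
Qed.

(** A jump that closes the wide gap only helps: the potential drops to 0,
    below the constant minus the new moment. *)
Lemma local_potential_push x (m j : int) (e : int) : labelling K N x ->
  (e = 1 /\ fwd x m) \/ (e = - 1 /\ bwd x m) ->
  local_potential (push K x m e) j - local_potential x j <=
  (wide_gap x j)%:R * (moment x j - moment (push K x m e) j).
Proof.
move=> lx h.
have lp : labelling K N (push K x m e).
  by case: h => [[-> ?]|[-> ?]]; [exact: push_fwd|exact: push_bwd].
have := @wide_gap_push x m j e lx h; have := moment_bound j lp.
rewrite /local_potential; case: (wide_gap _ _) => [_ -> //|]; first by rewrite mul1r; lia.
by case: (wide_gap x j) => // b _; rewrite ?mul1r ?mul0r; lia.
Qed.

Lemma potential_drift x : labelling K N x ->
  \sum_(m < K) ((fwd x m)%:R * (potential (push K x m 1) - potential x) +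
                (bwd x m)%:R * (potential (push K x m (- 1)) - potential x))
  <= - (2 * (2 * K%:Z - N%:Z)) * \sum_(j < K) (wide_gap x j)%:R.
Proof.
move=> lx.
have -> : \sum_(m < K) ((fwd x m)%:R * (potential (push K x m 1) - potential x) +
                (bwd x m)%:R * (potential (push K x m (- 1)) - potential x)) =
  \sum_(j < K) \sum_(m < K)
    ((fwd x m)%:R * (local_potential (push K x m 1) j - local_potential x j) +
     (bwd x m)%:R * (local_potential (push K x m (- 1)) j - local_potential x j)).
  rewrite exchange_big; apply: eq_bigr => m _.
  by rewrite big_split /= -!mulr_sumr !sumrB.
rewrite mulr_sumr; apply: ler_sum => j _.
apply: (@le_trans _ _ (\sum_(m < K) (wide_gap x j)%:R *
   - (((fwd x m)%:R - (bwd x m)%:R) *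
     \sum_(d < K) (2 * d%:Z + 1 - K%:Z) * delta K m (j%:Z + d%:Z + 1)))).
  apply: ler_sum => m _.
  have e1 := moment_push x m j 1; have e2 := moment_push x m j (- 1).
  have t1 := @local_potential_push x m j 1 lx; have t2 := @local_potential_push x m j (- 1) lx.
  set S := \sum_(d < K) _ in e1 e2 *.
  case: (boolP (fwd x m)) => f; case: (boolP (bwd x m)) => b;
    rewrite ?mul1r ?mul0r ?addr0 ?add0r ?subr0 ?sub0r.
  - by move: f b; rewrite /fwd /bwd; lia.
  - by apply: le_trans (t1 _) _; [left|rewrite ler_wpM2l //; lia].
  - by apply: le_trans (t2 _) _; [right|rewrite ler_wpM2l //; lia].
  - by rewrite ?oppr0 ?mulr0 ?subrr ?mul0r ?oppr0 ?mulr0.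
rewrite -mulr_sumr sumrN mulrC.
case: (boolP (wide_gap x j)) => g; last by rewrite !mulr0.
by rewrite !mulr1 lerN2; apply: moment_drift.
Qed.

Lemma potential_bounds x : labelling K N x ->
  (K ^ 2 * N)%N%:Z * \sum_(j < K) (wide_gap x j)%:R <= potential x
    <= 3 * (K ^ 2 * N)%N%:Z * \sum_(j < K) (wide_gap x j)%:R.
Proof.
move=> lx; rewrite !mulr_sumr; apply/andP.
by split; apply: ler_sum => j _; case/andP: (local_potential_bounds j lx).
Qed.

Lemma wide_gap_tight x : tight K N x -> \sum_(j < K) (wide_gap x j)%:R = 0 :> int.
Proof.
move=> [_ x2]; apply: big1 => j _.
suff -> : wide_gap x j = false by [].
by apply/negbTE; rewrite /wide_gap; have := x2 j; lia.
Qed.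

Lemma wide_gap_sum_ge1 x : labelling K N x -> ~ tight K N x ->
  1 <= \sum_(j < K) (wide_gap x j)%:R :> int.
Proof.
move=> lx ntx; rewrite leNgt; apply/negP => h; apply: ntx; split => // j.
have p : periodic K (fun j => (wide_gap x j)%:R).
  by move=> i; rewrite /wide_gap addrAC !lx.1 addrAC lerD2r.
have /= := le_lt_trans (periodic_sum_ge K_gt1 p (fun i => ler0n _ _) j) h.
by rewrite /wide_gap; case: (lerP (x j + 3)) => //; lia.
Qed.

Lemma wide_gap_sum_le x : \sum_(j < K) (wide_gap x j)%:R <= K%:Z :> int.
Proof.
have -> : K%:Z = \sum_(j < K) 1 by rewrite sumr_const card_ord natz.
by apply: ler_sum => j _; case: (wide_gap x j).
Qed.

End Transience.

(** * The generator in terms of labellings *)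

Section ConfigurationOfLabelling.
Variables K n : nat.
Let N := n.+1.

Definition site (z : int) : 'I_n.+1 := inord `|(z %% n.+1%:Z)%Z|.

Lemma val_site (z : int) : (site z : nat)%:Z = (z %% n.+1%:Z)%Z.
Proof.
have N0 : n.+1%:Z != 0 by lia.
have m0 := modz_ge0 z N0; have mN := ltz_mod z N0.
by rewrite /site inordK; lia.
Qed.

Lemma site_ord (y : 'I_n.+1) : site (y : nat)%:Z = y.
Proof.
apply: val_inj; apply/eqP; rewrite -eqz_nat val_site modz_small //.
by have := ltn_ord y; lia.
Qed.

Lemma site_eqP (z z' : int) :
  reflect (exists q : int, z' = z + q * N%:Z) (site z == site z').
Proof.
rewrite -val_eqE /= -eqz_nat !val_site; apply: (iffP eqP) => [e|[q ->]].
  exists ((z' %/ n.+1%:Z)%Z - (z %/ n.+1%:Z)%Z).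
  by rewrite {1}(divz_eq z' n.+1%:Z) {1}(divz_eq z n.+1%:Z) e /N; ring.
by rewrite addrC modzMDl.
Qed.

Lemma site_succ (z : int) : ordS (site z) = site (z + 1).
Proof.
apply: val_inj; apply/eqP; rewrite -eqz_nat /= val_site.
rewrite -modzDml -(val_site z). have -> : (site z : nat)%:Z + 1 = ((site z).+1)%:Z by lia.
by rewrite modz_nat.
Qed.

Lemma site_pred (z : int) : ord_pred (site z) = site (z - 1).
Proof. by rewrite -[z in LHS](subrK 1) -site_succ ordSK. Qed.

Lemma site_neq (z z' : int) : z < z' < z + N%:Z -> site z != site z'.
Proof.
move=> h; apply/negP => /site_eqP[q e].
have [q0|q1] : q <= 0 \/ 1 <= q by lia.
  have : q * N%:Z <= 0 by rewrite mulr_le0_ge0.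
  by lia.
have : 1 * N%:Z <= q * N%:Z by rewrite ler_wpM2r.
by lia.
Qed.

Definition config_of (x : int -> int) : config n.+1 :=
  [ffun y => y \in [set site (x (j : nat)%:Z) | j : 'I_K]].

Lemma eq_config_of x y : x =1 y -> config_of x = config_of y.
Proof. by move=> /funext ->. Qed.

Lemma exchangeK (y : 'I_n.+1) : involutive (@exchange n.+1 y).
Proof. by move=> eta; apply/ffunP => z; rewrite !ffunE tpermK. Qed.

Hypothesis K_gt1 : (1 < K)%N.
Hypothesis n_gt1 : (1 < n)%N.

Lemma config_ofP x (z : int) : labelling K N x ->
  reflect (exists j : int, x j = z) (config_of x (site z)).
Proof.
move=> lx; rewrite ffunE.
apply: (iffP imsetP) => [[j _ /eqP/site_eqP[q e]]|[j <-]].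
  exists (j%:Z - q * K%:Z); rewrite -mulNr (labellingM _ _ lx) e mulNr.
  by rewrite addrK.
have K0 : K%:Z != 0 by lia.
have m0 := modz_ge0 j K0; have mK := ltz_mod j K0.
have jK : (`|(j %% K)%Z| < K)%N by lia.
exists (Ordinal jK) => //=; apply/eqP; rewrite eq_sym; apply/site_eqP.
exists (j %/ K)%Z; rewrite gez0_abs // -(labellingM _ _ lx) {1}(divz_eq j K).
by rewrite addrC.
Qed.

Lemma config_of_site x (j : int) : labelling K N x -> config_of x (site (x j)).
Proof. by move=> lx; apply/(config_ofP _ lx); exists j. Qed.

(** Labellings are increasing, so no particle sits strictly between two
    consecutive ones. *)
Lemma config_of_between x (j z : int) : labelling K N x -> x j < z < x (j + 1) ->
  config_of x (site z) = false.
Proof.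
move=> lx h; apply/(config_ofP _ lx) => -[i e].
have [ij|ij] : i <= j \/ j + 1 <= i by lia.
  by have := labelling_le lx ij; lia.
by have := labelling_le lx ij; lia.
Qed.

Lemma config_of_next x (j : int) : labelling K N x ->
  config_of x (site (x j + 1)) = (x (j + 1) == x j + 1).
Proof.
move=> lx; have x1 := lx.2 j.
have [<-|ne] := eqVneq (x (j + 1)) (x j + 1); first exact: config_of_site.
by apply: (config_of_between (j := j)) => //; lia.
Qed.

Lemma config_of_prev x (j : int) : labelling K N x ->
  config_of x (site (x j - 1)) = (x j == x (j - 1) + 1).
Proof.
move=> lx; have := lx.2 (j - 1); rewrite subrK => x1.
have [->|ne] := eqVneq (x j) (x (j - 1) + 1); first by rewrite addrK config_of_site.
by apply: (config_of_between (j := j - 1)) => //; rewrite subrK; lia.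
Qed.

Lemma site_inj x : labelling K N x -> injective (fun j : 'I_K => site (x (j : nat)%:Z)).
Proof.
move=> lx i j /eqP/site_eqP[q]; rewrite -(labellingM _ _ lx) => /(labelling_inj lx) e.
apply: val_inj => /=; have := ltn_ord i; have := ltn_ord j => ? ?.
have [q0|[q1|q1]] : q = 0 \/ (1 <= q \/ q <= -1) by lia.
- by move: e; rewrite q0 mul0r; lia.
- have : 1 * K%:Z <= q * K%:Z by rewrite ler_wpM2r.
  by lia.
- have : q * K%:Z <= - 1 * K%:Z by rewrite ler_wpM2r.
  by lia.
Qed.

Lemma sum_particles (R : realType) x (G : 'I_n.+1 -> R) : labelling K N x ->
  \sum_y (config_of x y)%:R * G y = \sum_(j < K) G (site (x (j : nat)%:Z)).
Proof.
move=> lx.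
rewrite -[RHS](@big_imset _ _ _ _ _ _ predT) /=; last first.
  by move=> i j _ _; apply: (site_inj lx).
rewrite [RHS]big_mkcond; apply: eq_bigr => y _; rewrite ffunE.
by rewrite (_ : (_ \in _) = (y \in [set site (x (j : nat)%:Z) | j : 'I_K])) //;
   case: ifP => _; rewrite ?mul1r ?mul0r.
Qed.

Lemma config_of_push1 x (j : int) : labelling K N x -> labelling K N (push K x j 1) ->
  config_of (push K x j 1) = exchange (site (x j)) (config_of x).
Proof.
move=> lx lp; apply/ffunP => y; rewrite [RHS]ffunE site_succ.
have N0 : N%:Z != 0 by lia.
pose d := (((y : nat)%:Z - x j) %% N%:Z)%Z.
have [d0 dN] : 0 <= d /\ d < N%:Z.
  by split; [exact: modz_ge0|have := ltz_mod ((y : nat)%:Z - x j) N0; lia].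
have [z [zy z0 zN]] : exists z, [/\ y = site z, x j <= z & z < x j + N%:Z].
  exists (x j + d); split; try lia.
  apply/eqP; rewrite -[y]site_ord; apply/site_eqP.
  exists (- (((y : nat)%:Z - x j)%R %/ N%:Z)%Z).
  have := divz_eq ((y : nat)%:Z - x j) N%:Z; rewrite -/d; lia.
rewrite zy.
have pj : push K x j 1 j = x j + 1 by rewrite /push delta_refl mul1r.
have pj1 : push K x j 1 (j - 1) = x (j - 1).
  by rewrite /push (delta_pred K_gt1 (delta_refl K j)) mulr0 addr0.
have pj2 : push K x j 1 (j + 1) = x (j + 1).
  by rewrite /push (delta_succ K_gt1 (delta_refl K j)) mulr0 addr0.
have xj := lx.2 (j - 1); rewrite subrK in xj.
have xj' := lp.2 j; rewrite pj pj2 in xj'.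
have [->|ne0] := eqVneq z (x j).
  rewrite tpermL (@config_of_between x j) //; last by lia.
  by rewrite (@config_of_between (push K x j 1) (j - 1)) // subrK pj pj1; lia.
have [->|ne1] := eqVneq z (x j + 1).
  by rewrite tpermR config_of_site // -pj config_of_site.
rewrite tpermD; try by apply: site_neq; lia.
apply/(config_ofP _ lp)/(config_ofP _ lx) => -[i e]; exists i; move: e; rewrite /push;
  case: (delta_labelling j i lx) => [[q [-> ei _ _]]|->]; rewrite ?mulr0 ?addr0 //;
  have [q0|q1] : q <= 0 \/ 1 <= q by lia.
- have : q * N%:Z <= 0 by rewrite mulr_le0_ge0.
  by lia.
- have : 1 * N%:Z <= q * N%:Z by rewrite ler_wpM2r.
  by lia.
- have : q * N%:Z <= 0 by rewrite mulr_le0_ge0.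
  by lia.
- have : 1 * N%:Z <= q * N%:Z by rewrite ler_wpM2r.
  by lia.
Qed.

Lemma config_of_pushN1 x (j : int) : labelling K N x -> labelling K N (push K x j (- 1)) ->
  config_of (push K x j (- 1)) = exchange (ord_pred (site (x j))) (config_of x).
Proof.
move=> lx lp.
have e : push K (push K x j (- 1)) j 1 =1 x by move=> i; rewrite /push; ring.
have le : labelling K N (push K (push K x j (- 1)) j 1).
  by case: lx => a b; split => i; rewrite !e.
have := config_of_push1 lp le; rewrite (eq_config_of e) => ->.
by rewrite {2}/push delta_refl mulr1 site_pred exchangeK.
Qed.

(** The second half of the rate is reindexed so that both halves are attached
    to the particle that jumps; the sum over sites then becomes a sum over
    particles. *)
Lemma generator_labelling (R : realType) (f : config n.+1 -> R) x : labelling K N x ->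
  fep_generator f (config_of x) =
  \sum_(m < K)
    ((fwd x m)%:R * (f (config_of (push K x m 1)) - f (config_of x)) +
     (bwd x m)%:R * (f (config_of (push K x m (- 1))) - f (config_of x))).
Proof.
move=> lx; set eta := config_of x; rewrite /fep_generator /fep_rate.
under eq_bigr => y _ do rewrite mulrDl.
rewrite big_split /=.
(* In the backward jumps, index the bond by its right end, where the particle
   sits. *)
rewrite [X in _ + X](reindex_inj (can_inj (@ord_predK n.+1))) /=.
rewrite -big_split /=.
under eq_bigr => y _ do rewrite !ord_predK.
pose G (y : 'I_n.+1) : R :=
  (eta (ord_pred y))%:R * (1 - (eta (ordS y))%:R) * (f (exchange y eta) - f eta)
  + (1 - (eta (ord_pred y))%:R) * (eta (ordS y))%:R *
    (f (exchange (ord_pred y) eta) - f eta).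
rewrite (eq_bigr (fun y => (eta y)%:R * G y)); last first.
  by move=> y _; rewrite /G; ring.
rewrite sum_particles //; apply: eq_bigr => m _.
rewrite /G site_succ site_pred /eta config_of_next // config_of_prev // -/eta.
have x1 := lx.2 m; have := lx.2 (m%:Z - 1); rewrite subrK => x0.
have [f1|nf1] := boolP (fwd x m).
  have fe : config_of (push K x m 1) = exchange (site (x m)) eta.
    by apply: config_of_push1 => //; exact: push_fwd.
  rewrite fe; move: f1; rewrite /fwd /bwd => f1.
  have -> : (x m == x (m%:Z - 1) + 1) by lia.
  have -> : (x (m%:Z + 1) == x m + 1) = false by apply/negbTE; lia.
  rewrite andbF mulr1n mulr0n; ring.
have [b1|nb1] := boolP (bwd x m).
  have fe : config_of (push K x m (- 1)) = exchange (site (x m - 1)) eta.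
    by rewrite -site_pred; apply: config_of_pushN1 => //; exact: push_bwd.
  rewrite fe; move: b1; rewrite /bwd => b1.
  have -> : (x m == x (m%:Z - 1) + 1) = false by apply/negbTE; lia.
  have -> : (x (m%:Z + 1) == x m + 1) by lia.
  rewrite mulr1n mulr0n; ring.
move: nf1 nb1; rewrite /fwd /bwd => nf1 nb1.
have -> : (x (m%:Z + 1) == x m + 1) = (x m == x (m%:Z - 1) + 1).
  by apply/idP/idP; lia.
by case: (x m == _) => /=; ring.
Qed.

Lemma generator_tight (R : realType) (f : config n.+1 -> R) x : tight K N x ->
  fep_generator f (config_of x) =
  \sum_(m < K) (f (config_of (swap_gaps K x m)) - f (config_of x)).
Proof.
move=> tx; rewrite generator_labelling //; last exact: tx.1.
apply: eq_bigr => m _; have [g g'] := tight_gap tx m.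
rewrite /swap_gaps /fwd /bwd.
have [e|[e|e]] : x (m%:Z - 1) + x (m%:Z + 1) - 2 * x m = 1 \/
  (x (m%:Z - 1) + x (m%:Z + 1) - 2 * x m = - 1 \/
   x (m%:Z - 1) + x (m%:Z + 1) - 2 * x m = 0) by lia.
- have -> : (x m == x (m%:Z - 1) + 1) && (x m + 2 <= x (m%:Z + 1)) by lia.
  have -> : (x (m%:Z - 1) + 2 <= x m) && (x (m%:Z + 1) == x m + 1) = false.
    by apply/negbTE; lia.
  by rewrite e mul1r mul0r addr0.
- have -> : (x m == x (m%:Z - 1) + 1) && (x m + 2 <= x (m%:Z + 1)) = false.
    by apply/negbTE; lia.
  have -> : (x (m%:Z - 1) + 2 <= x m) && (x (m%:Z + 1) == x m + 1) by lia.
  by rewrite e mul1r mul0r add0r.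
- have -> : (x m == x (m%:Z - 1) + 1) && (x m + 2 <= x (m%:Z + 1)) = false.
    by apply/negbTE; lia.
  have -> : (x (m%:Z - 1) + 2 <= x m) && (x (m%:Z + 1) == x m + 1) = false.
    by apply/negbTE; lia.
  by rewrite e (eq_config_of (@push0 K x m)) subrr !mul0r addr0.
Qed.

End ConfigurationOfLabelling.

(** * Labelling a configuration, and stationarity of the uniform law *)

Section Configurations.
Variables K n : nat.
Hypothesis K_gt1 : (1 < K)%N.
Hypothesis n_gt1 : (1 < n)%N.
Let N := n.+1.

(** List the occupied sites in increasing order and extend the list
    quasi-periodically. *)
Lemma labelling_exists (eta : config n.+1) : nparticles eta = K ->
  exists x, [/\ labelling K N x, config_of K n x = eta &
    forall j : int, 0 <= j < K%:Z -> 0 <= x j < N%:Z].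
Proof.
move=> npK.
pose s : seq nat := [seq val i | i <- enum 'I_n.+1 & eta i].
have sK : size s = K.
  rewrite size_map size_filter -npK /nparticles -sum1_count big_mkcond /=.
  by rewrite big_enum /=; apply: eq_bigr => i _; case: (eta i).
have s_sorted : sorted ltn s.
  apply: (subseq_sorted ltn_trans (s2 := iota 0 n.+1)); last exact: iota_ltn_sorted.
  by rewrite -val_enum_ord map_subseq // filter_subseq.
have sN (k : nat) : (k < K)%N -> (nth 0%N s k < N)%N.
  move=> kK; have : nth 0%N s k \in s by rewrite mem_nth ?sK.
  by case/mapP => i _ ->; exact: ltn_ord.
have s_mono (k : nat) : (k.+1 < K)%N -> (nth 0%N s k < nth 0%N s k.+1)%N.
  by move=> kK; apply: (sorted_ltn_nth ltn_trans 0%N s_sorted);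
    rewrite ?inE ?sK //; lia.
have K0 : K%:Z != 0 by lia.
pose x (j : int) : int := (nth 0%N s `|(j %% K%:Z)%Z|)%:Z + (j %/ K%:Z)%Z * N%:Z.
have xE (k : nat) (q : int) : (k < K)%N ->
    x (k%:Z + q * K%:Z) = (nth 0%N s k)%:Z + q * N%:Z.
  move=> kK; rewrite /x [k%:Z + _]addrC modzMDl divzMDl // modz_small; last by lia.
  by rewrite divz_small ?addr0 //; lia.
have dec (j : int) : exists k : nat, exists q : int,
    (k < K)%N /\ j = k%:Z + q * K%:Z.
  have m0 := modz_ge0 j K0; have mK := ltz_mod j K0.
  exists `|(j %% K%:Z)%Z|%N, (j %/ K%:Z)%Z; split; first by lia.
  by rewrite gez0_abs // addrC -divz_eq.
have lx : labelling K N x.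
  split => j; have [k [q [kK ->]]] := dec j.
    have -> : k%:Z + q * K%:Z + K%:Z = k%:Z + (q + 1) * K%:Z by ring.
    by rewrite !xE //; ring.
  have [k1|k1] : (k.+1 < K \/ k.+1 = K)%N by lia.
    have -> : k%:Z + q * K%:Z + 1 = k.+1%:Z + q * K%:Z.
      by rewrite intS; ring.
    by rewrite !xE //; have := s_mono _ k1; lia.
  have -> : k%:Z + q * K%:Z + 1 = 0%N%:Z + (q + 1) * K%:Z.
    by rewrite -k1 intS; ring.
  by rewrite !xE //; [have := sN _ kK; lia | lia].
exists x; split => //.
  apply/ffunP => y; rewrite -[y](site_ord).
  apply/(config_ofP K_gt1 n_gt1 _ lx)/idP.
    move=> [j ej]; have [k [q [kK jE]]] := dec j.
    have : nth 0%N s k \in s by rewrite mem_nth ?sK.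
    case/mapP => i; rewrite mem_filter => /andP[etai _] ei.
    suff -> : site n (y : nat)%:Z = i by [].
    rewrite -(site_ord i); apply/eqP; rewrite eq_sym; apply/site_eqP => //.
    by exists q; rewrite -ej jE xE // ei.
  rewrite (site_ord) => etay.
  have ys : (y : nat) \in s.
    by apply/mapP; exists y => //; rewrite mem_filter etay mem_enum.
  exists (index (y : nat) s)%:Z.
  have := xE (index (y : nat) s) 0; rewrite !mul0r !addr0 => -> //.
    by rewrite nth_index.
  by rewrite -sK index_mem.
move=> j jK; have := xE `|j|%N 0; rewrite !mul0r !addr0 gez0_abs; last by lia.
by move=> ->; [have := sN `|j|%N; lia | lia].
Qed.

Lemma in_ergodic (eta : config n.+1) : (eta \in ergodic_component n.+1 K) =
  (nparticles eta == K) && [forall y, eta y || eta (ordS y)].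
Proof.
rewrite inE; congr (_ && _); apply: eq_forallb => y.
by case: (eta y); case: (eta (ordS y)).
Qed.

Lemma ergodic_tight x : labelling K N x ->
  config_of K n x \in ergodic_component n.+1 K -> tight K N x.
Proof.
move=> lx; rewrite in_ergodic => /andP[_ /forallP erg]; split => // j.
rewrite leNgt; apply/negP => g3.
have := erg (site n (x j + 1)); rewrite site_succ //.
by rewrite !(@config_of_between K n K_gt1 n_gt1 x j) //; lia.
Qed.

Lemma nparticles_exchange (y : 'I_n.+1) (eta : config n.+1) :
  nparticles (exchange y eta) = nparticles eta.
Proof.
rewrite /nparticles [RHS](reindex_inj (@perm_inj _ (tperm y (ordS y)))) /=.
by apply: eq_bigr => i _; rewrite ffunE.
Qed.

Lemma ordS_neq (y : 'I_n.+1) : ordS y != y.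
Proof.
rewrite -[y](site_ord) site_succ // eq_sym; apply: site_neq => //; lia.
Qed.

Lemma ordSS_neq (y : 'I_n.+1) : ordS (ordS y) != y.
Proof.
rewrite -[y](site_ord) !site_succ // eq_sym; apply: site_neq => //; lia.
Qed.

Lemma exchange_ergodic_away (y z : 'I_n.+1) (eta : config n.+1) :
  [forall u, eta u || eta (ordS u)] -> z != ord_pred y -> z != y ->
  z != ordS y -> exchange y eta z || exchange y eta (ordS z).
Proof.
move=> /forallP erg zp zy zs; rewrite !ffunE tpermD 1?eq_sym // tpermD //.
  by apply: contra zp => /eqP ->; rewrite ordSK.
by apply: contra zy => /eqP e; rewrite -(ordSK z) -e ordSK.
Qed.

(** Inside the ergodic component the kinetic constraint holds exactly when the
    exchange stays in the component. This makes the rates symmetric, so that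
    the uniform law is reversible. *)
Lemma rate_ergodic (R : realType) (y : 'I_n.+1) (eta : config n.+1) :
  eta \in ergodic_component n.+1 K -> eta y != eta (ordS y) ->
  fep_rate R y eta = (exchange y eta \in ergodic_component n.+1 K)%:R.
Proof.
rewrite !in_ergodic nparticles_exchange => /andP[-> erg] ne /=.
have ey : exchange y eta y = eta (ordS y) by rewrite ffunE tpermL.
have es : exchange y eta (ordS y) = eta y by rewrite ffunE tpermR.
have sy := ordS_neq y; have ssy := ordSS_neq y.
have py : ord_pred y != y by rewrite -{2}(ord_predK y) eq_sym ordS_neq.
have psy : ord_pred y != ordS y.
  by rewrite -{2}(ord_predK y) eq_sym ordSS_neq.
have ep : exchange y eta (ord_pred y) = eta (ord_pred y).
  by rewrite ffunE tpermD // eq_sym.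
have ess : exchange y eta (ordS (ordS y)) = eta (ordS (ordS y)).
  by rewrite ffunE tpermD // eq_sym // ordS_neq.
rewrite /fep_rate; move: ne ey es.
case: (eta y) => /=; case: (eta (ordS y)) => //= _ ey es.
  rewrite subrr subr0 !mul0r addr0 !mulr1; congr ((nat_of_bool _)%:R).
  apply/idP/forallP => [epy z|/(_ (ord_pred y))]; last first.
    by rewrite ep ord_predK ey orbF => ->.
  have [->|zp] := eqVneq z (ord_pred y); first by rewrite ep epy.
  have [->|zy] := eqVneq z y; first by rewrite es orbT.
  have [->|zs] := eqVneq z (ordS y); first by rewrite es.
  exact: exchange_ergodic_away.
rewrite !mulr0 !mul0r add0r subr0 !mul1r; congr ((nat_of_bool _)%:R).
apply/idP/forallP => [epy z|/(_ (ordS y))]; last by rewrite es ess.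
have [->|zp] := eqVneq z (ord_pred y); first by rewrite ord_predK ey orbT.
have [->|zy] := eqVneq z y; first by rewrite ey.
have [->|zs] := eqVneq z (ordS y); first by rewrite ess epy orbT.
exact: exchange_ergodic_away.
Qed.

Lemma generator_stationary (R : realType) (f : config n.+1 -> R) :
  \sum_(eta in ergodic_component n.+1 K) fep_generator f eta = 0.
Proof.
rewrite /fep_generator exchange_big /=; apply: big1 => y _.
set E := ergodic_component n.+1 K.
rewrite (eq_bigr (fun eta => (exchange y eta \in E)%:R *
           (f (exchange y eta) - f eta))) => [|eta etaE]; last first.
  have [e|ne] := eqVneq (eta y) (eta (ordS y)); last by rewrite rate_ergodic.
  suff -> : exchange y eta = eta by rewrite subrr !mulr0.
  by apply/ffunP => z; rewrite ffunE; case: tpermP => [->|->|].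
under eq_bigr => eta _ do rewrite mulrBr.
rewrite sumrB; apply/eqP; rewrite subr_eq0; apply/eqP.
rewrite [LHS](reindex_inj (inv_inj (@exchangeK n y))) /= big_mkcond [RHS]big_mkcond.
apply: eq_bigr => eta _; rewrite exchangeK.
by case: (eta \in E); case: (_ \in E); rewrite ?mul1r ?mul0r.
Qed.
End Configurations.

(** * Contraction of the generator *)

Section Contraction.
Variables (R : realType) (K n : nat).
Local Notation N := n.+1.
Hypothesis K_gt1 : (1 < K)%N.
Hypothesis KN : (K < N)%N.
Hypothesis N2K : (N < 2 * K)%N.

Let n_gt1 : (1 < n)%N. Proof. by move: KN; lia. Qed.

Local Notation k := (GRing.one R *+ K).
Local Notation l := (GRing.one R *+ n.+1).
Let k_ge2 : 2 <= k :> R. Proof. by rewrite ler_nat. Qed.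
Let kl : k + 1 <= l :> R. Proof. by rewrite natr1 ler_nat. Qed.
Let l2k : l + 1 <= 2 * k :> R. Proof. by rewrite natr1 -natrM ler_nat. Qed.

Local Ltac klra := pose proof l2k; pose proof kl; pose proof k_ge2; lra.

(** The slope b in d (b - d), large enough for (N - K) cost 1 <= cost K; it is
    finite because the density exceeds 1/2. *)
Definition cost_slope : R := K%:R ^+ 2 / (2 * K%:R - n.+1%:R).

Definition cost (d : int) : R := d%:~R * (cost_slope - d%:~R).

(** A common lower bound for the decay rates of the cost and of the potential.
    *)
Definition decay_rate : R := (2 * K%:R - n.+1%:R) / (3 * n.+1%:R ^+ 3).

Lemma cost_slopeE : cost_slope * (2 * k - l) = k ^+ 2.
Proof.
rewrite /cost_slope divfK ?gt_eqF //.
klra.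
Qed.

Lemma cost_slope_ge : k + 1 <= cost_slope.
Proof.
rewrite /cost_slope ler_pdivlMr; last by klra.
have : (k + 1) * (2 * k - l) <= (k + 1) * (k - 1) by rewrite ler_wpM2l //; klra.
have -> : (k + 1) * (k - 1) = k ^+ 2 - 1 by ring.
klra.
Qed.

Lemma int_le_k (d : int) : 0 <= d <= K%:Z -> 0 <= (d%:~R : R) <= k.
Proof.
by move=> /andP[d0 dK]; rewrite ler0z d0 /= [K%:R]pmulrn ler_int.
Qed.

Lemma cost_ge1 (d : int) : 0 < d <= K%:Z -> 1 <= cost d.
Proof.
move=> d0; have /andP[_ dk] := @int_le_k d ltac:(lia).
have d1 : 1 <= d%:~R :> R by rewrite ler1z; lia.
by apply: mulr_ege1 => //; have := cost_slope_ge; klra.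
Qed.

Lemma cost_bounds (d : int) : 0 <= d <= K%:Z -> 0 <= cost d <= k * cost_slope.
Proof.
move=> /int_le_k/andP[d0 dk]; have b := cost_slope_ge.
rewrite /cost; apply/andP; split; first by apply: mulr_ge0 => //; klra.
by apply: ler_pM => //; klra.
Qed.

(** Rotating a configuration by one site, which takes N - K single moves,
    costs no more than the maximal displacement. *)
Lemma cost_turn : (l - k) * cost 1 <= cost K%:Z.
Proof.
rewrite /cost -pmulrn.
by have := cost_slopeE; klra.
Qed.

Lemma cost0 : cost 0 = 0. Proof. by rewrite /cost mul0r. Qed.

Lemma cost1_bounds : 1 <= cost 1 <= cost_slope.
Proof. by rewrite /cost; have := cost_slope_ge; klra. Qed.

Local Notation F f x := (f (config_of K n x)).

(** A seminorm on functions: Lipschitz continuity for the cost along the close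
    pairs that are neither equal nor rotations of each other. *)
Definition cost_lipschitz (A : R) (f : config n.+1 -> R) :=
  forall x y, close_pair K N x y -> 0 < displacement K x y < K%:Z ->
  `|F f x - F f y| <= A * cost (displacement K x y).

(** Move from x up to y by pushing one particle at a time. *)
Lemma cost_lipschitz_path (A : R) f : 0 <= A -> cost_lipschitz A f ->
  forall (d : nat) x y, tight K N x -> tight K N y ->
  (forall j : int, x j <= y j) -> displacement K x y = d%:Z ->
  `|F f x - F f y| <= d%:R * (A * cost 1).
Proof.
move=> A0 cf; elim=> [|d ih] x y tx ty xy S.
  have e : x =1 y.
    by move=> j; have := displacement_ge K_gt1 tx.1 ty.1 xy j; have := xy j; lia.
  by rewrite (eq_config_of K n e) subrr normr0 mul0r.
have [j0 j0P] : exists j, x j < y j.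
  apply: contrapT => nex; move: S; rewrite /displacement big1 ?subr_ge0 // => i _.
  by have := xy i; case: (ltP (x i) (y i)) => [h|]; [case: nex; exists i%:Z|lia].
have [j [xyj e1 e2]] := push_towards K_gt1 KN N2K tx ty xy (ex_intro _ j0 j0P).
set z := push K x j 1.
have tz : tight K N z by apply: push_tight => //; lia.
have zx (i : int) : z i = x i + delta K j i by rewrite /z /push mul1r.
have zy (i : int) : z i <= y i.
  rewrite zx; case: (deltaP K j i) => [[q -> ->]|[_ ->]]; last by have := xy i; lia.
  by rewrite (labellingM _ _ tx.1) (labellingM _ _ ty.1); lia.
have Sz : displacement K z y = d%:Z.
  by rewrite /z displacement_pushl // S; lia.
have Sxz : displacement K x z = 1.
  by rewrite /z displacement_pushr // /displacement big1 // => i _; rewrite subrr.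
have pxz : close_pair K N x z.
  by split => // i; rewrite zx; case: (delta01 K j i) => ->; lia.
have h1 := cf x z pxz; rewrite Sxz in h1.
have {}h1 := h1 ltac:(lia).
have h2 := ih z y tz ty zy Sz.
have -> : F f x - F f y = (F f x - F f z) + (F f z - F f y) by ring.
apply: le_trans (ler_normD _ _) _.
by rewrite -nat1r mulrDl mul1r; apply: lerD.
Qed.

Lemma tight_shift x : tight K N x -> tight K N (fun j => x (j + 1)).
Proof.
move=> [[xa x1] x2]; split; first split => j.
- by rewrite addrAC xa.
- exact: x1.
- by move=> j; apply: x2.
Qed.

Lemma config_of_shift x : labelling K N x -> labelling K N (fun j => x (j + 1)) ->
  config_of K n (fun j => x (j + 1)) = config_of K n x.
Proof.
move=> lx lx'; apply/ffunP => y; rewrite -[y]site_ord.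
apply/(config_ofP K_gt1 n_gt1 _ lx')/(config_ofP K_gt1 n_gt1 _ lx) => -[j <-].
  by exists (j + 1).
by exists (j - 1); rewrite subrK.
Qed.

(** The remaining case is y = x + 1: then x, relabelled by one, lies above y
    at displacement N - K, and cost_turn absorbs the length of the path. *)
Lemma cost_lipschitz_close (A : R) f : 0 <= A -> cost_lipschitz A f ->
  forall x y, close_pair K N x y ->
  `|F f x - F f y| <= A * cost (displacement K x y).
Proof.
move=> A0 cf x y pxy; have Sb := close_pair_displacement K_gt1 pxy.
have [tx ty xy] := pxy.
have [S0|S0] := eqVneq (displacement K x y) 0.
  by rewrite (eq_config_of K n (displacement0 K_gt1 pxy S0)) subrr normr0 S0 cost0 mulr0.
have [SK|SK] := eqVneq (displacement K x y) K%:Z; last by apply: cf => //; lia.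
rewrite SK; have yx := displacementK K_gt1 pxy SK.
have ts := tight_shift tx.
rewrite -(config_of_shift tx.1 ts.1) distrC.
have Sd : displacement K y (fun j => x (j + 1)) = (N - K)%N%:Z.
  rewrite /displacement.
  rewrite (eq_bigr (fun j : 'I_K => x (0 + (j : nat)%:Z + 1) - x (0 + (j : nat)%:Z) - 1)).
    by rewrite sumrB telescope_ord tx.1.1 sumr_const card_ord natz; lia.
  by move=> j _; rewrite yx !add0r; ring.
apply: le_trans (cost_lipschitz_path A0 cf ty ts _ Sd) _.
  by move=> j; rewrite yx; exact: tx.1.2.
rewrite natrB; last by lia.
by rewrite mulrCA ler_wpM2l // cost_turn.
Qed.

(** The right-hand side is the cost of the pair before and after a common
    move. *)
Lemma cost_step (d w : int) : `|w| <= 1 ->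
  2 * cost d + w%:~R * (cost_slope - 2 * d%:~R) - `|w|%:~R =
  cost d + cost (d + w).
Proof.
move=> hw; have [->|[->|->]] : w = 0 \/ (w = 1 \/ w = -1) by lia.
- by rewrite addr0 /cost normr0 mul0r; ring.
- by rewrite /cost normr1 intrD mul1r; ring.
- by rewrite /cost normrN1 intrD; ring.
Qed.

(** Adding 2 K to the generator makes its expansion over moves and over
    coupled moves have non negative coefficients. *)
Definition shifted_generator (f : config n.+1 -> R) (eta : config n.+1) : R :=
  2 * k * f eta + fep_generator f eta.

(** For |w| = 2 the four terms are grouped as the two close pairs in which
    only one labelling has moved. In all cases the bound is the same concave
    increment of the cost. *)
Lemma cost_lipschitz_swap_gaps (A : R) f x y (m w d : int) : 0 <= A -> cost_lipschitz A f ->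
  close_pair K N x y ->
  w = laplacian (fun j => y j - x j) m -> d = displacement K x y ->
  `|F f (swap_gaps K x m) - F f (swap_gaps K y m) + (F f x - F f y)| <=
  A * (2 * cost d + w%:~R * (cost_slope - 2 * d%:~R) - `|w|%:~R).
Proof.
move=> A0 cf pxy ew ed; have /= := close_pair_swap_gaps K_gt1 m pxy.
rewrite -ew -ed; have cc := cost_lipschitz_close A0 cf.
have [tx ty xy] := pxy.
have wb : -2 <= w <= 2.
  by rewrite ew /laplacian; have := xy m; have := xy (m - 1); have := xy (m + 1); lia.
case: ifP => hw.
  move=> [ps Ss]; apply: le_trans (ler_normD _ _) _.
  have h1 := cc _ _ ps; have h2 := cc _ _ pxy; rewrite Ss in h1; rewrite -ed in h2.
  by rewrite cost_step // mulrDr addrC; apply: lerD.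
move=> [p1 p2 S1 S2].
have -> : F f (swap_gaps K x m) - F f (swap_gaps K y m) + (F f x - F f y) =
  (F f x - F f (swap_gaps K y m)) + (F f (swap_gaps K x m) - F f y) by ring.
apply: le_trans (ler_normD _ _) _.
have h1 := cc _ _ p1; have h2 := cc _ _ p2.
apply: le_trans (lerD h1 h2) _.
have [w2|w2] : w = 2 \/ w = -2 by lia.
  have e1 : displacement K x (swap_gaps K y m) = d + 1 by lia.
  have e2 : displacement K (swap_gaps K x m) y = d + 1 by lia.
  rewrite e1 e2 -mulrDr w2 /cost intrD.
  by rewrite le_eqVlt; apply/orP; left; apply/eqP; congr (_ * _); rewrite ger0_norm //; ring.
have e1 : displacement K x (swap_gaps K y m) = d - 1 by lia.
have e2 : displacement K (swap_gaps K x m) y = d - 1 by lia.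
rewrite e1 e2 -mulrDr w2 /cost intrD.
by rewrite le_eqVlt; apply/orP; left; apply/eqP; congr (_ * _); rewrite normrN ger0_norm //; ring.
Qed.

Lemma decay_rate_bounds : [/\ 0 < decay_rate, decay_rate * (k * cost_slope) <= 1,
  decay_rate * (2 * (k ^+ 2 * l)) <= 2 * k - l & decay_rate <= 1].
Proof.
have l0 : 0 < l by klra.
have l3 : 0 < 3 * l ^+ 3 by rewrite mulr_gt0 // exprn_gt0.
have kk : k ^+ 2 * l <= l ^+ 3.
  by rewrite [l ^+ 3]exprSr ler_wpM2r // lerXn2r ?nnegrE //; klra.
have k3 : k ^+ 3 <= l ^+ 3 by rewrite lerXn2r ?nnegrE //; klra.
rewrite /decay_rate; split.
- by rewrite divr_gt0 //; klra.
- have -> : (2 * k - l) / (3 * l ^+ 3) * (k * cost_slope) = k ^+ 3 / (3 * l ^+ 3).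
    rewrite mulrAC mulrCA [(2 * k - l) * _]mulrC cost_slopeE.
    by rewrite [in RHS]exprS.
  by rewrite ler_pdivrMr // mul1r; have := exprn_gt0 3 l0; klra.
- rewrite mulrAC ler_pdivrMr // ler_wpM2l //; [klra|].
  by have := exprn_gt0 3 l0; klra.
- rewrite ler_pdivrMr // mul1r.
  have : l * 1 <= l * l ^+ 2 by rewrite ler_wpM2l // exprn_ege1 //; klra.
  by rewrite -exprS; klra.
Qed.

(** Sum the previous bound over m: the first-order terms vanish as a Laplacian
    sums to zero over a period, and the second-order terms leave a gain of at
    least 1, which is a fraction decay_rate of the cost. *)
Lemma shifted_generator_lipschitz (A : R) f : 0 <= A -> cost_lipschitz A f ->
  cost_lipschitz ((2 * k - decay_rate) * A) (shifted_generator f).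
Proof.
move=> A0 cf x y pxy S; have [tx ty xy] := pxy.
set d := displacement K x y in S *; pose v (j : int) : int := y j - x j.
have b m := cost_lipschitz_swap_gaps A0 cf pxy (erefl (laplacian v m)) (erefl d).
have -> : F (shifted_generator f) x - F (shifted_generator f) y =
  \sum_(m < K) (F f (swap_gaps K x (m : nat)%:Z) - F f (swap_gaps K y (m : nat)%:Z)
    + (F f x - F f y)).
  rewrite /shifted_generator !generator_tight //.
  have e (c : R) : 2 * k * c = \sum_(m < K) 2 * c.
    by rewrite sumr_const card_ord -mulr_natl; ring.
  rewrite !e opprD addrACA -!sumrB -big_split /=.
  by apply: eq_bigr => m _; ring.
apply: le_trans (ler_norm_sum _ _ _) _.
apply: (@le_trans _ _ (\sum_(m < K) A * (2 * cost d +
    (laplacian v (m : nat)%:Z)%:~R * (cost_slope - 2 * d%:~R) -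
    `|laplacian v (m : nat)%:Z|%:~R))).
  by apply: ler_sum => m _; exact: b.
rewrite -mulr_sumr mulrAC [leRHS]mulrC ler_wpM2l //.
rewrite sumrB big_split /= -[X in _ + X - _]mulr_suml.
have s0 : \sum_(m < K) (laplacian v (m : nat)%:Z)%:~R = 0 :> R.
  by rewrite -(raddf_sum (intr : int -> R)) (_ : \sum_(m < K) _ = 0) //;
    exact (laplacian_sum0 K_gt1 tx.1 ty.1).
rewrite s0 mul0r addr0 -(raddf_sum (intr : int -> R)).
rewrite sumr_const card_ord -mulr_natl.
have : 1 <= (\sum_(m < K) `|laplacian v (m : nat)%:Z|)%:~R :> R.
  by rewrite ler1z; exact (laplacian_sum_ge1 K_gt1 pxy S).
have [r0 r1 _ _] := decay_rate_bounds.
have : decay_rate * cost d <= 1.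
  apply: le_trans r1; apply: ler_wpM2l; first exact: ltW.
  by have /andP[] := @cost_bounds d ltac:(lia).
by move=> h1 h2; rewrite mulrBl; klra.
Qed.

Definition diameter : R := 2 * l * k * cost 1.

Lemma diameter_ge1 : 1 <= diameter.
Proof.
rewrite /diameter; have /andP[c1 _] := cost1_bounds.
by apply: mulr_ege1 => //; apply: mulr_ege1; klra.
Qed.

(** Choose labellings x of the first and y of the second configuration with
    values between 0 and N - 1 on a period; then y + N lies above x at
    displacement at most 2 N K. *)
Lemma cost_lipschitz_ergodic (A : R) f : 0 <= A -> cost_lipschitz A f ->
  forall eta zeta, eta \in ergodic_component N K ->
  zeta \in ergodic_component N K -> `|f eta - f zeta| <= A * diameter.
Proof.
move=> A0 cf eta zeta etaE zetaE.
have [x [lx ex xb]] : exists x, [/\ labelling K N x, config_of K n x = eta &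
    forall j : int, 0 <= j < K%:Z -> 0 <= x j < N%:Z].
  by apply: labelling_exists => //; move: etaE; rewrite in_ergodic => /andP[/eqP].
have [y [ly ey yb]] : exists x, [/\ labelling K N x, config_of K n x = zeta &
    forall j : int, 0 <= j < K%:Z -> 0 <= x j < N%:Z].
  by apply: labelling_exists => //; move: zetaE; rewrite in_ergodic => /andP[/eqP].
have tx : tight K N x by apply: ergodic_tight => //; rewrite ex.
have ty : tight K N y by apply: ergodic_tight => //; rewrite ey.
(* Translating by N changes neither the configuration nor tightness, and puts
   the second labelling above the first. *)
pose z (j : int) : int := y j + N%:Z.
have tz : tight K N z.
  case: ty => -[ya y1] y2; rewrite /z; split; first split => j.
  - by rewrite ya.
  - by have := y1 j; lia.
  - by move=> j; have := y2 j; lia.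
have ez : config_of K n z = zeta.
  rewrite -ey; apply/ffunP => s; rewrite -[s]site_ord.
  apply/(config_ofP K_gt1 n_gt1 _ tz.1)/(config_ofP K_gt1 n_gt1 _ ly) => -[j <-].
    by exists (j + K%:Z); rewrite ly.1.
  by exists (j - K%:Z); rewrite /z -ly.1 subrK.
have xz0 (j : int) : 0 <= j < K%:Z -> 0 <= z j - x j <= 2 * N%:Z.
  by move=> jK; have := xb j jK; have := yb j jK; rewrite /z; lia.
have xz (j : int) : x j <= z j.
  have p := diff_periodic K_gt1 tx.1 tz.1.
  have K0 : K%:Z != 0 by lia.
  have m0 := modz_ge0 j K0; have mK := ltz_mod j K0.
  have := xz0 (j %% K%:Z)%Z ltac:(lia).
  have := periodicM (j %% K%:Z)%Z (j %/ K%:Z)%Z p.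
  rewrite [_ + _ * _]addrC -divz_eq /=; lia.
have S0 : 0 <= displacement K x z.
  by apply: sumr_ge0 => j _; rewrite subr_ge0.
have SN : displacement K x z <= (2 * N * K)%N%:Z.
  have -> : (2 * N * K)%N%:Z = \sum_(j < K) 2 * N%:Z.
    by rewrite sumr_const card_ord; lia.
  by apply: ler_sum => j _; have := xz0 (j : nat)%:Z; have := ltn_ord j; lia.
have Se : displacement K x z = `|displacement K x z|%N%:Z by rewrite gez0_abs.
have := cost_lipschitz_path A0 cf tx tz xz Se; rewrite ex ez => h.
apply: le_trans h _; rewrite mulrCA ler_wpM2l // /diameter ler_wpM2r //.
  by have /andP[] := cost1_bounds; klra.
by rewrite -!natrM ler_nat; lia.
Qed.

Lemma mean0_ergodic (A : R) f : 0 <= A -> cost_lipschitz A f ->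
  \sum_(eta in ergodic_component N K) f eta = 0 ->
  forall eta, eta \in ergodic_component N K -> `|f eta| <= A * diameter.
Proof.
move=> A0 cf f0 eta etaE.
set E := ergodic_component N K in f0 etaE.
have E0 : 0 < #|E|%:R :> R by rewrite ltr0n; apply/card_gt0P; exists eta.
have e : f eta * #|E|%:R = \sum_(zeta in E) (f eta - f zeta).
  by rewrite sumrB f0 subr0 sumr_const mulr_natr.
rewrite -(ler_pM2r E0) -[X in _ * X <= _]ger0_norm // -normrM e.
apply: le_trans (ler_norm_sum _ _ _) _.
have -> : A * diameter * #|E|%:R = \sum_(zeta in E) A * diameter.
  by rewrite sumr_const mulr_natr.
by apply: ler_sum => zeta zetaE; apply: cost_lipschitz_ergodic.
Qed.

Lemma floor_exists x (z : int) : labelling K N x ->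
  exists j : int, x j <= z < x (j + 1).
Proof.
move=> lx.
have [a a0] : exists a : nat, x 0 - z <= a%:Z 
  by move: (x 0 - z) => c; exists (absz c); lia.
have [b x0] : exists b : int, x b <= z.
  exists (0 + (- a%:Z) * K%:Z); rewrite (labellingM _ _ lx).
  have : (- a%:Z) * N%:Z <= (- a%:Z) * 1 by apply: ler_wnM2l; lia.
  by move: a0; move: (x 0) => c a0 h; lia.
have ex : exists d : nat, z < x (b + d%:Z + 1).
  have [d dz] : exists d : nat, z - x b <= d%:Z.
    by move: (z - _) => c; exists (absz c); lia.
  exists d; have h := labelling_ge (b + 1) d lx; have h' := lx.2 b.
  have e : b + 1 + d%:Z = b + d%:Z + 1 by ring.
  by rewrite e in h; lia.
case: (ex_minnP ex) => d hd dmin; exists (b + d%:Z); rewrite hd andbT.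
case: d hd dmin => [|d] hd dmin; first by rewrite addr0.
rewrite leNgt; apply/negP => h; have := dmin d.
have -> : b + d%:Z + 1 = b + d.+1%:Z by lia.
by move=> /(_ h); lia.
Qed.

Lemma config_of_ergodic x : tight K N x -> config_of K n x \in ergodic_component N K.
Proof.
move=> tx; have lx := tx.1; rewrite in_ergodic; apply/andP; split.
  have := sum_particles K_gt1 n_gt1 (fun=> 1 : R) lx.
  rewrite sumr_const card_ord; under eq_bigr => y _ do rewrite mulr1.
  by rewrite -natr_sum => /eqP; rewrite eqr_nat.
apply/forallP => y; rewrite -[y]site_ord site_succ.
have [j /andP[h1 h2]] := floor_exists (y : nat)%:Z lx.
have [h3|h3] : x j = (y : nat)%:Z \/ x (j + 1) = (y : nat)%:Z + 1.
  by have := tx.2 j; lia.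
  by rewrite -h3 config_of_site.
by rewrite -h3 config_of_site ?orbT.
Qed.

(** The bound allowed at x in the control of functions: the diameter on the
    ergodic component, and more when there are wide gaps left to drain. *)
Definition weight (x : int -> int) : R :=
  diameter * (1 + (potential K N x)%:~R / (k ^+ 2 * l)).

Let w0 : 0 < k ^+ 2 * l :> R.
Proof. by rewrite mulr_gt0 // ?exprn_gt0 // ltr0n; lia. Qed.

Lemma weight_tight x : tight K N x -> weight x = diameter.
Proof.
move=> tx; have := potential_bounds K_gt1 tx.1; rewrite (wide_gap_tight K_gt1 tx) !mulr0.
move=> h; have e : potential K N x = 0 by lia.
by rewrite /weight e mul0r addr0 mulr1.
Qed.

Lemma weight_bounds x : labelling K N x ->
  diameter <= weight x <=
    diameter * (1 + 3 * (\sum_(j < K) (wide_gap x (j : nat)%:Z)%:R : int)%:~R).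
Proof.
move=> lx; have /andP[] := potential_bounds K_gt1 lx.
set c := (\sum_(j < K) _ : int) => h1 h2.
have c0 : 0 <= c by apply: sumr_ge0.
have d1 := diameter_ge1.
have kl0 : (k ^+ 2 * l = ((K ^ 2 * N)%N%:Z)%:~R :> R).
  by rewrite -pmulrn natrM natrX.
have t0 : 0 <= (potential K N x)%:~R :> R.
  by rewrite ler0z; apply: le_trans h1; apply: mulr_ge0.
apply/andP; split.
  rewrite /weight -[leLHS]mulr1 ler_wpM2l //; first by lra.
  by rewrite lerDl divr_ge0 // ltW.
rewrite /weight ler_wpM2l //; first by lra.
rewrite lerD2l ler_pdivrMr // kl0 -[3]/(3%:~R) -!intrM ler_int.
by apply: le_trans h2 _; rewrite mulrAC.
Qed.

Lemma weight_drift x : labelling K N x -> ~ tight K N x ->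
  \sum_(m < K) ((fwd x m)%:R * (weight (push K x m 1) - weight x) +
                (bwd x m)%:R * (weight (push K x m (- 1)) - weight x))
  <= - decay_rate * weight x.
Proof.
move=> lx ntx; have := potential_drift K_gt1 lx.
have c1 := wide_gap_sum_ge1 K_gt1 lx ntx.
have /andP[_] := weight_bounds lx.
set c := (\sum_(j < K) (wide_gap x _)%:R : int) in c1 *.
move=> wb h.
have c1' : 1 <= c%:~R :> R by rewrite ler1z.
pose a := diameter / (k ^+ 2 * l).
have a0 : 0 < a by rewrite divr_gt0 //; have := diameter_ge1; lra.
have we y : weight y - weight x = a * (potential K N y - potential K N x)%:~R.
  by rewrite /weight /a intrB; ring.
under eq_bigr => m _.
  rewrite !we.
  have -> : (fwd x m)%:R * (a * (potential K N (push K x m 1) - potential K N x)%:~R) +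
    (bwd x m)%:R * (a * (potential K N (push K x m (- 1)) - potential K N x)%:~R) =
    a * ((fwd x m)%:R * (potential K N (push K x m 1) - potential K N x) +
    (bwd x m)%:R * (potential K N (push K x m (- 1)) - potential K N x))%:~R.
    by rewrite [in RHS]intrD !intrM !mulrz_nat; ring.
  over.
rewrite -mulr_sumr -(raddf_sum (intr : int -> R)).
apply: (@le_trans _ _ (a * (- (2 * (2 * K%:Z - N%:Z)) * c)%:~R)).
  by rewrite ler_pM2l // ler_int.
have -> : (- (2 * (2 * K%:Z - N%:Z)) * c)%:~R = - (2 * (2 * k - l) * c%:~R) :> R.
  rewrite !(intrM, rmorphN, intrD) /=; ring.
rewrite mulrN mulNr lerN2.
have [r0 _ r2 _] := decay_rate_bounds.
apply: (@le_trans _ _ (decay_rate * (diameter * (4 * c%:~R)))).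
  apply: ler_wpM2l; first exact: ltW.
  apply: le_trans wb _; apply: ler_wpM2l; last by lra.
  by have := diameter_ge1; lra.
rewrite /a [leRHS]mulrAC ler_pdivlMr //.
have -> : decay_rate * (diameter * (4 * c%:~R)) * (k ^+ 2 * l) =
  diameter * (2 * (decay_rate * (2 * (k ^+ 2 * l))) * c%:~R) by ring.
apply: ler_wpM2l; first by have := diameter_ge1; lra.
by apply: ler_wpM2r; lra.
Qed.

(** The three properties that are propagated together: Lipschitz on the
    ergodic component and mean zero there, which bounds the function on the
    component, and bounded by the weight elsewhere. *)
Definition controlled (A : R) (f : config n.+1 -> R) :=
  [/\ cost_lipschitz A f, \sum_(eta in ergodic_component N K) f eta = 0 &
    forall x, labelling K N x -> `|F f x| <= A * weight x].

(** On the ergodic component the bound by the weight follows from the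
    Lipschitz and mean zero properties. Elsewhere it follows from positivity
    and the drift of the weight. *)
Lemma shifted_generator_controlled (A : R) f : 0 <= A -> controlled A f ->
  controlled ((2 * k - decay_rate) * A) (shifted_generator f).
Proof.
move=> A0 [cf f0 wf].
have [r0 _ _ r1] := decay_rate_bounds.
have cb := shifted_generator_lipschitz A0 cf.
have A1 : 0 <= (2 * k - decay_rate) * A by rewrite mulr_ge0 //; klra.
have b0 : \sum_(eta in ergodic_component N K) shifted_generator f eta = 0.
  by rewrite big_split /= -mulr_sumr f0 mulr0 add0r generator_stationary.
split => // x lx.
have [tx|ntx] := pselect (tight K N x).
  rewrite weight_tight //; apply: (mean0_ergodic A1 cb b0).
  exact: config_of_ergodic.
rewrite /shifted_generator generator_labelling //.
have e (c : R) : 2 * k * c = \sum_(m < K) 2 * c.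
  by rewrite sumr_const card_ord -mulr_natl; ring.
rewrite e -big_split /=.
apply: le_trans (ler_norm_sum _ _ _) _.
apply: (@le_trans _ _ (A * (2 * k * weight x + \sum_(m < K)
  ((fwd x m)%:R * (weight (push K x m 1) - weight x) +
   (bwd x m)%:R * (weight (push K x m (- 1)) - weight x))))); last first.
  rewrite [(2 * k - decay_rate) * A]mulrC -[leRHS]mulrA; apply: ler_wpM2l => //.
  by have := weight_drift lx ntx; rewrite mulrBl mulNr; lra.
rewrite e -big_split /= mulr_sumr; apply: ler_sum => m _.
have h0 := wf _ lx.
have [f1|f1] := boolP (fwd x m); have [b1|b1] := boolP (bwd x m);
  rewrite ?mulr1n ?mulr0n ?mul1r ?mul0r ?addr0 ?add0r.
- by move: f1 b1; rewrite /fwd /bwd; lia.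
- have h1 := wf _ (push_fwd K_gt1 lx f1).
  have -> : 2 * F f x + (F f (push K x m 1) - F f x) = F f x + F f (push K x m 1) by ring.
  apply: le_trans (ler_normD _ _) _; apply: le_trans (lerD h0 h1) _.
  by rewrite -mulrDr; apply: ler_wpM2l => //; lra.
- have h1 := wf _ (push_bwd K_gt1 lx b1).
  have -> : 2 * F f x + (F f (push K x m (- 1)) - F f x) = F f x + F f (push K x m (- 1)) by ring.
  apply: le_trans (ler_normD _ _) _; apply: le_trans (lerD h0 h1) _.
  by rewrite -mulrDr; apply: ler_wpM2l => //; lra.
- by rewrite normrM ger0_norm // mulrCA ler_wpM2l.
Qed.

Lemma iter_shifted_generator_controlled (A : R) f (i : nat) : 0 <= A -> controlled A f ->
  controlled ((2 * k - decay_rate) ^+ i * A) (iter i shifted_generator f).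
Proof.
move=> A0 cf; elim: i => [|i ih]; first by rewrite mul1r.
rewrite iterS exprS -mulrA; apply: shifted_generator_controlled => //.
have [r0 _ _ r1] := decay_rate_bounds.
by rewrite mulr_ge0 // exprn_ge0 //; klra.
Qed.

Lemma iter_shifted_generator_bound f : (forall eta zeta, `|f eta - f zeta| <= 1) ->
  (forall eta, `|f eta| <= 1) ->
  \sum_(eta in ergodic_component N K) f eta = 0 ->
  forall eta (i : nat), nparticles eta = K ->
  `|iter i shifted_generator f eta| <= (2 * k - decay_rate) ^+ i * (diameter * (1 + 3 * k)).
Proof.
move=> osc f1 f0 eta i npK.
have [r0 _ _ r1] := decay_rate_bounds; have d1 := diameter_ge1.
have cf : controlled 1 f.
  split => // [x y _ S|x lx]; rewrite mul1r.
    by apply: le_trans (osc _ _) _; apply: cost_ge1; lia.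
  by apply: le_trans (f1 _) _; have /andP[] := weight_bounds lx; lra.
have [x [lx ex _]] := labelling_exists K_gt1 n_gt1 npK.
have [_ _ /(_ x lx)] := iter_shifted_generator_controlled i ler01 cf.
rewrite ex mulr1 => h; apply: le_trans h _; apply: ler_wpM2l.
  by rewrite exprn_ge0 //; klra.
have /andP[_ h] := weight_bounds lx; apply: le_trans h _.
apply: ler_wpM2l; first by lra.
by rewrite lerD2l ler_wpM2l // [leRHS]pmulrn ler_int wide_gap_sum_le.
Qed.

End Contraction.

(** * Exponential series and Cauchy products *)

Local Open Scope classical_set_scope.

Section CauchyProduct.
Variable R : realType.

Definition convolution (p q : nat -> R) (m : nat) : R :=
  \sum_(i < m.+1) q i * p (m - i)%N.

Lemma series_convolution (p q : nat -> R) (n : nat) :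
  series (convolution p q) n = \sum_(i < n) q i * series p (n - i)%N.
Proof.
elim: n => [|n ih]; first by rewrite big_ord0 /series /= big_geq.
rewrite seriesSr ih [RHS]big_ord_recr /= subSnn.
rewrite /convolution big_ord_recr /= subnn addrA -big_split /=.
congr (_ + _); last by rewrite /series /= big_nat1.
apply: eq_bigr => i _; rewrite -mulrDr subSn ?seriesSr //.
exact: ltnW.
Qed.

(** The defect of the truncated Cauchy product only involves products of
    terms, so it is dominated by the defect of the majorants. *)
Lemma cauchy_defect_bound (p q P Q : nat -> R) (n : nat) :
  (forall i, `|p i| <= P i) -> (forall i, `|q i| <= Q i) ->
  `|series p n * series q n - series (convolution p q) n| <=
  series P n * series Q n - series (convolution P Q) n.
Proof.
move=> pP qQ; rewrite !series_convolution.
have e (a b : nat -> R) : series a n * series b n = \sum_(i < n) b i * series a n.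
  by rewrite mulrC /series /= big_mkord mulr_suml.
rewrite !e -!sumrB; apply: le_trans (ler_norm_sum _ _ _) _.
apply: ler_sum => i _; rewrite -!mulrBr normrM ler_pM //.
rewrite !sub_series leq_subr.
by apply: le_trans (ler_norm_sum _ _ _) _; apply: ler_sum.
Qed.

Lemma expR_convolution (a b : R) :
  convolution (exp_coeff a) (exp_coeff b) = exp_coeff (a + b).
Proof.
apply/funext => m; rewrite /convolution /exp_coeff /= exprDn mulr_suml.
apply: eq_bigr => i _; have im : (i <= m)%N by rewrite -ltnS.
have f0 (j : nat) : j`!%:R != 0 :> R by rewrite pnatr_eq0 -lt0n fact_gt0.
rewrite -mulr_natr -(bin_fact im) !natrM.
have c0 : 'C(m, i)%:R != 0 :> R by rewrite pnatr_eq0 -lt0n bin_gt0.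
by field; rewrite c0 !f0.
Qed.

(** The defect for the majorants tends to 0, since their Cauchy product is
    again an exponential series. *)
Lemma cvg_exp_convolution (a b W : R) (q : nat -> R) :
  0 <= a -> 0 <= b -> 0 <= W ->
  (forall i, `|q i| <= W * (b ^+ i / i`!%:R)) ->
  exists2 s : R, series (convolution (exp_coeff (- a)) q) @ \oo --> s &
    `|s| <= W * expR (b - a).
Proof.
move=> a0 b0 W0 qQ.
pose Q i := W * exp_coeff b i.
have cQ : series Q @ \oo --> W * expR b.
  have -> : series Q = fun n => W * series (exp_coeff b) n.
    by apply/funext => n; rewrite /series /= mulr_sumr.
  by apply: cvgMr; exact: is_cvg_series_exp_coeff.
have cvgq : cvgn (series q).
  apply: normed_cvg; apply: (series_le_cvg _ _ qQ).
  - by move=> i; exact: normr_ge0.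
  - by move=> i; rewrite mulr_ge0 // divr_ge0 // exprn_ge0.
  - by apply/cvg_ex; exists (W * expR b).
have cp (x : R) : series (exp_coeff x) @ \oo --> expR x by exact: is_cvg_series_exp_coeff.
have defect : series (exp_coeff a) n * series Q n -
    series (convolution (exp_coeff a) Q) n @[n --> \oo] --> (0 : R).
  have -> : convolution (exp_coeff a) Q = fun m => W * exp_coeff (a + b) m.
    apply/funext => m; rewrite -expR_convolution /convolution mulr_sumr.
    by apply: eq_bigr => i _; rewrite /Q mulrA.
  rewrite -[0](subrr (expR a * (W * expR b))); apply: cvgB.
    by apply: cvgM.
  rewrite mulrCA -expRD.
  have -> : series (fun m => W * exp_coeff (a + b) m) =
            fun n => W * series (exp_coeff (a + b)) n.
    by apply/funext => n; rewrite /series /= mulr_sumr.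
  by apply: cvgMr.
have defect' : series (exp_coeff (- a)) n * series q n -
    series (convolution (exp_coeff (- a)) q) n @[n --> \oo] --> (0 : R).
  apply: norm_cvg0; apply: squeeze_cvgr defect; last exact: cvg_cst.
  near=> n; rewrite normr_ge0 /=; apply: cauchy_defect_bound => //.
  by move=> i; rewrite /exp_coeff /= normrM normrX normrN (ger0_norm a0) ger0_norm.
exists (expR (- a) * limn (series q)).
  have -> : series (convolution (exp_coeff (- a)) q) = fun n =>
     series (exp_coeff (- a)) n * series q n -
     (series (exp_coeff (- a)) n * series q n -
      series (convolution (exp_coeff (- a)) q) n).
    by apply/funext => n; rewrite subKr.
  rewrite -[X in _ --> X]subr0; apply: cvgB => //.
  by apply: cvgM.
rewrite normrM ger0_norm ?expR_ge0 // expRD mulrA mulrC.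
apply: ler_wpM2r; first exact: expR_ge0.
rewrite -(cvg_lim _ cQ) //.
apply: le_trans (lim_series_norm _) _.
  apply: (series_le_cvg _ _ qQ).
  - by move=> i; exact: normr_ge0.
  - by move=> i; rewrite mulr_ge0 // divr_ge0 // exprn_ge0.
  - by apply/cvg_ex; exists (W * expR b).
apply: lim_series_le => //.
- apply: (series_le_cvg _ _ qQ).
  + by move=> i; exact: normr_ge0.
  + by move=> i; rewrite mulr_ge0 // divr_ge0 // exprn_ge0.
  + by apply/cvg_ex; exists (W * expR b).
- by apply/cvg_ex; exists (W * expR b).
Unshelve. all: by end_near. Qed.

End CauchyProduct.

Section ShiftedIterates.
Variables (R : realType) (T : Type) (L : (T -> R) -> T -> R).
Hypothesis L_linear : forall (a : R) f g,
  L (fun x => f x + a * g x) = fun x => L f x + a * L g x.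
Variable c : R.

Definition shift_op (f : T -> R) (x : T) : R := c * f x + L f x.

Lemma iter_shift_op_linear i (a : R) f g :
  iter i shift_op (fun x => f x + a * g x) =
  fun x => iter i shift_op f x + a * iter i shift_op g x.
Proof.
elim: i => //= i ->; apply/funext => x; rewrite /shift_op L_linear; ring.
Qed.

(** Pascal's rule. *)
Lemma binomial_step (y : R) (g : nat -> R) (m : nat) :
  \sum_(i < m.+2) 'C(m.+1, i)%:R * y ^+ (m.+1 - i) * g i =
  \sum_(i < m.+1) 'C(m, i)%:R * y ^+ (m - i) * g i.+1 +
  y * \sum_(i < m.+1) 'C(m, i)%:R * y ^+ (m - i) * g i.
Proof.
rewrite big_ord_recl /= bin0 subn0.
under eq_bigr => i _ do rewrite /bump /= add1n subSS binS natrD !mulrDl.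
rewrite big_split /= [RHS]addrC addrA; congr (_ + _).
have -> : y * \sum_(i < m.+1) 'C(m, i)%:R * y ^+ (m - i) * g i =
    \sum_(i < m.+2) 'C(m, i)%:R * y ^+ (m.+1 - i) * g i.
  rewrite [RHS]big_ord_recr /= bin_small // !mul0r addr0 mulr_sumr.
  apply: eq_bigr => i _; rewrite subSn ?exprS; last by rewrite -ltnS.
  ring.
rewrite [RHS]big_ord_recl /= bin0 subn0; congr (_ + _).
Qed.

(** The binomial formula for L = (c + L) - c. *)
Lemma iter_unshift m f x :
  iter m L f x =
  \sum_(i < m.+1) 'C(m, i)%:R * (- c) ^+ (m - i) * iter i shift_op f x.
Proof.
elim: m f => [|m ih] f; first by rewrite big_ord1 bin0 expr0 !mul1r.
rewrite iterSr ih (binomial_step (- c) (fun i => iter i shift_op f x)) mulr_sumr.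
rewrite -big_split /=; apply: eq_bigr => i _.
have -> : L f = fun x => shift_op f x + (- c) * f x.
  by apply/funext => z; rewrite /shift_op; ring.
by rewrite iter_shift_op_linear -iterSr iterS mulrDr [in LHS]mulrCA.
Qed.

(** This is exp (t L) = exp (- c t) exp (t (c + L)), with the second
    exponential bounded term by term. *)
Lemma exp_series_bound (f : T -> R) (x : T) (r W t : R) :
  0 <= c -> 0 <= r -> 0 <= W -> 0 <= t ->
  (forall i, `|iter i shift_op f x| <= r ^+ i * W) ->
  exists2 s : R,
    series (fun i => t ^+ i / i`!%:R * iter i L f x) @ \oo --> s &
    `|s| <= W * expR ((r - c) * t).
Proof.
move=> c0 r0 W0 t0 fW.
pose q i := t ^+ i / i`!%:R * iter i shift_op f x.
have f0 (j : nat) : j`!%:R != 0 :> R by rewrite pnatr_eq0 -lt0n fact_gt0.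
have -> : (fun i => t ^+ i / i`!%:R * iter i L f x) =
    convolution (exp_coeff (- (c * t))) q.
  apply/funext => m; rewrite iter_unshift /convolution mulr_sumr.
  apply: eq_bigr => i _; have im : (i <= m)%N by rewrite -ltnS.
  rewrite /q /exp_coeff /= -mulNr exprMn -[in t ^+ m](subnKC im) exprD.
  have -> : m`!%:R = 'C(m, i)%:R * (i`!%:R * (m - i)`!%:R) :> R.
    by rewrite -(bin_fact im) !natrM.
  have cb : 'C(m, i)%:R != 0 :> R by rewrite pnatr_eq0 -lt0n bin_gt0.
  by field; rewrite cb !f0.
have [] := @cvg_exp_convolution R (c * t) (r * t) W q _ _ W0.
- exact: mulr_ge0.
- exact: mulr_ge0.
- move=> i; rewrite /q normrM ger0_norm ?divr_ge0 ?exprn_ge0 //.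
  apply: le_trans (ler_wpM2l _ (fW i)) _; first by rewrite divr_ge0 ?exprn_ge0.
  by rewrite le_eqVlt; apply/orP; left; apply/eqP; rewrite exprMn; ring.
- by move=> s cs sb; exists s => //; rewrite mulrBl.
Qed.

End ShiftedIterates.

(** * The mixing time *)

Section MixingTime.
Variable R : realType.

Lemma generator_linear N (a : R) (f g : config N -> R) :
  fep_generator (fun x => f x + a * g x) =
  fun x => fep_generator f x + a * fep_generator g x.
Proof.
apply/funext => eta; rewrite /fep_generator mulr_sumr -big_split /=.
by apply: eq_bigr => y _; ring.
Qed.

Lemma generator_cst N (a : R) (f : config N -> R) :
  fep_generator (fun x => f x - a) = fep_generator f.
Proof.
apply/funext => eta; rewrite /fep_generator.
by apply: eq_bigr => y _; congr (_ * _); ring.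
Qed.

(** The semigroup is applied to the indicator of A minus its mean, which is
    controlled with constant 1; subtracting a constant changes only the zeroth
    term of the exponential series. *)
Lemma fep_law_bound (K n : nat) (eta : config n.+1) (t : R)
    (A : {set config n.+1}) :
  (1 < K)%N -> (K < n.+1)%N -> (n.+1 < 2 * K)%N ->
  nparticles eta = K -> 0 <= t ->
  `|fep_law eta t A - fep_invariant R K A| <=
  diameter R K n * (1 + 3 * K%:R) * expR (- (decay_rate R K n * t)).
Proof.
move=> K_gt1 KN N2K npK t0.
set E := ergodic_component n.+1 K; set mu := fep_invariant R K A.
have mu01 : 0 <= mu <= 1.
  rewrite /mu /fep_invariant divr_ge0 //=.
  have [->|E0] := eqVneq #|E| 0%N; first by rewrite invr0 mulr0 ler01.
  rewrite ler_pdivrMr ?ltr0n ?lt0n // mul1r ler_nat.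
  exact: subset_leq_card (finset.subsetIr _ _).
pose h (xi : config n.+1) : R := (xi \in A)%:R - mu.
have h1 xi : `|h xi| <= 1.
  by rewrite /h ler_norml; case: (xi \in A); rewrite ?mulr1n ?mulr0n; lra.
have hosc xi zeta : `|h xi - h zeta| <= 1.
  rewrite /h ler_norml.
  by case: (xi \in A); case: (zeta \in A); rewrite ?mulr1n ?mulr0n; lra.
have h0 : \sum_(xi in E) h xi = 0.
  rewrite sumrB sumr_const -[X in X - _]natr_sum.
  have -> : (\sum_(xi in E) (xi \in A) = #|A :&: E|)%N.
    rewrite -sum1_card big_mkcond [RHS]big_mkcond /=.
    apply: eq_bigr => xi _; rewrite finset.in_setI.
    by case: (xi \in A); case: (xi \in E).
  rewrite /mu /fep_invariant -/E -[X in _ - X]mulr_natr.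
  have [E0|E0] := eqVneq #|E| 0%N.
    rewrite E0 mulr0 subr0; apply/eqP; rewrite pnatr_eq0 -leqn0 -E0.
    exact: subset_leq_card (finset.subsetIr _ _).
  by rewrite divfK ?subrr // pnatr_eq0.
have [r0 _ _ r1] := decay_rate_bounds R K_gt1 KN N2K.
have K2 : 2 <= K%:R :> R by rewrite ler_nat.
have W0 : 0 <= diameter R K n * (1 + 3 * K%:R).
  by rewrite mulr_ge0 //; have := diameter_ge1 R K_gt1 KN N2K; lra.
have shiftedE : shift_op (@fep_generator R n.+1) (2 * K%:R) = shifted_generator (R := R) K (n := n).
  by [].
have hb i : `|iter i (shift_op (@fep_generator R n.+1) (2 * K%:R)) h eta| <=
    (2 * K%:R - decay_rate R K n) ^+ i * (diameter R K n * (1 + 3 * K%:R)).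
  by rewrite shiftedE; apply: iter_shifted_generator_bound.
have [||s cs sb] := exp_series_bound (@generator_linear n.+1) _ _ W0 t0 hb.
- by lra.
- by lra.
suff -> : fep_law eta t A = s + mu.
  by rewrite addrK; move: sb; rewrite addrAC subrr add0r mulNr.
rewrite /fep_law /fep_semigroup; apply: cvg_lim => //.
(* The two series differ only in their zeroth terms, by mu. *)
rewrite -cvg_shiftS /=.
have hL k : iter k.+1 (@fep_generator R n.+1) (fun xi => (xi \in A)%:R) =
            iter k.+1 (@fep_generator R n.+1) h.
  by rewrite !iterSr /h generator_cst.
have -> : (fun m => series (fun k => t ^+ k / k`!%:R *
     iter k (@fep_generator R n.+1) (fun xi => (xi \in A)%:R) eta) m.+1) =
   fun m => series (fun k => t ^+ k / k`!%:R *
     iter k (@fep_generator R n.+1) h eta) m.+1 + mu.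
  apply/funext => m; rewrite /series /= !big_nat_recl //=.
  under eq_bigr => k _ do rewrite -iterS hL.
  by rewrite expr0 fact0 divr1 !mul1r /h addrAC subrK.
apply: cvgD; last exact: cvg_cst.
by rewrite (cvg_shiftS (series _)).
Qed.

(** The prefactor is at most 8 N^4 / kappa, and the exponential is at most
    N^(-5) at this time. *)
Lemma bound_asymptotics (K n : nat) (kappa t : R) :
  (1 < K)%N -> (K < n.+1)%N -> (n.+1 < 2 * K)%N ->
  0 < kappa -> kappa * n.+1%:R <= 2 * K%:R - n.+1%:R ->
  t = 15 / kappa * (n.+1%:R ^+ 2 * ln n.+1%:R) ->
  diameter R K n * (1 + 3 * K%:R) * expR (- (decay_rate R K n * t)) <=
  8 / (kappa * n.+1%:R).
Proof.
move=> K_gt1 KN N2K ka0 ka te; set l : R := n.+1%:R in ka te *; set k : R := K%:R in ka *.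
have l1 : 1 <= l by rewrite /l ler1n.
have k2 : 2 <= k by rewrite /k ler_nat.
have kl : k + 1 <= l by rewrite /k /l natr1 ler_nat.
have l0 : 0 < l by lra.
have kal : 0 < kappa * l by rewrite mulr_gt0.
have lnl : 0 <= ln l by apply: ln_ge0.
have dia : diameter R K n <= 2 * l ^+ 3 / kappa.
  have slope : cost_slope R K n <= l / kappa.
    rewrite /cost_slope -/k -/l ler_pdivrMr; last by lra.
    rewrite mulrAC ler_pdivlMr //.
    apply: (@le_trans _ _ (l * (kappa * l))); last by rewrite ler_wpM2l //; lra.
    rewrite mulrCA mulrC ler_wpM2l //; [lra|].
    by rewrite -expr2 lerXn2r ?nnegrE //; lra.
  have /andP[c1 c2] := cost1_bounds R K_gt1 KN N2K.
  rewrite /diameter -/k -/l.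
  have -> : 2 * l ^+ 3 / kappa = 2 * l * l * (l / kappa) by ring.
  apply: ler_pM; [by rewrite !mulr_ge0 //; lra|lra| |lra].
  by rewrite ler_wpM2l //; lra.
have w : diameter R K n * (1 + 3 * k) <= 8 * l ^+ 4 / kappa.
  have -> : 8 * l ^+ 4 / kappa = 2 * l ^+ 3 / kappa * (4 * l) by ring.
  by apply: ler_pM => //; [have := diameter_ge1 R K_gt1 KN N2K|..]; lra.
have e : expR (- (decay_rate R K n * t)) <= (l ^+ 5)^-1.
  rewrite -[l in l ^+ 5]lnK ?posrE // -expRM_natl -expRN ler_expR lerN2.
  have -> : decay_rate R K n * t = 5 * ln l * ((2 * k - l) / (kappa * l)).
    by rewrite te /decay_rate -/k -/l; field; rewrite !gt_eqF.
  rewrite ler_peMr ?mulr_ge0 // ler_pdivlMr // mul1r; lra.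
apply: (@le_trans _ _ (8 * l ^+ 4 / kappa * (l ^+ 5)^-1)).
  apply: ler_pM; rewrite ?expR_ge0 //.
  by rewrite mulr_ge0 //; have := diameter_ge1 R K_gt1 KN N2K; lra.
rewrite le_eqVlt; apply/orP; left; apply/eqP; field.
by rewrite !gt_eqF.
Qed.

Lemma fep_distance_bound (K n : nat) (t b : R) :
  (1 < K)%N -> (K < n.+1)%N -> (n.+1 < 2 * K)%N -> 0 <= t -> 0 <= b ->
  diameter R K n * (1 + 3 * K%:R) * expR (- (decay_rate R K n * t)) <= b ->
  fep_distance n.+1 K t <= b.
Proof.
move=> K_gt1 KN N2K t0 b0 hb; apply: bigmax_le => // eta /eqP npK.
apply: bigmax_le => // A _.
by apply: le_trans hb; apply: fep_law_bound.
Qed.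

End MixingTime.

Theorem proposition2p4 (R : realType) (rho eps : R)
  (hrho : 1 / 2 < rho < 1) (heps : 0 < eps < 1) :
  exists C : R, 0 < C /\
    forall K : nat -> nat,
      (forall N : nat, (0 < N)%N ->
        N%:R / 2 < (K N)%:R :> R /\ (K N <= N)%N) ->
      (K N)%:R / N%:R @[N --> \oo] --> rho ->
      (limn_esup (fun N : nat =>
        fep_mixing_time N (K N) eps * ((N%:R ^+ 2 * ln N%:R)^-1)%:E)
        <= C%:E)%E.
Proof.
(* Eventually 2 K - N >= kappa N, half of the limiting excess of particles
   over holes. *)
pose kappa := rho - 1 / 2.
have ka0 : 0 < kappa by rewrite /kappa; lra.
have C0 : 0 < 15 / kappa by rewrite divr_gt0.
exists (15 / kappa); split => // K _ Krho.
have K1 : \forall N \near \oo, (K N)%:R / N%:R < 1 :> R.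
  by apply: (cvgr_lt rho) => //; lra.
have K2 : \forall N \near \oo, rho - kappa / 2 < (K N)%:R / N%:R :> R.
  by apply: (cvgr_gt rho) => //; lra.
have N1 : \forall N \near \oo, Num.max 4 (8 / (kappa * eps)) <= N%:R :> R.
  exact: nbhs_infty_ger.
have main N : (K N)%:R / N%:R < 1 :> R -> rho - kappa / 2 < (K N)%:R / N%:R ->
    Num.max 4 (8 / (kappa * eps)) <= N%:R :> R ->
    (fep_mixing_time N (K N) eps * ((N%:R ^+ 2 * ln N%:R)^-1)%:E <= (15 / kappa)%:E)%E.
  rewrite ge_max => k1 k2 /andP[N4 Neps].
  case: N k1 k2 N4 Neps => [|n k1 k2 N4 Neps]; first by move=> _ _ h; exfalso; lra.
  set l : R := n.+1%:R in k1 k2 N4 Neps *; set k : R := (K n.+1)%:R in k1 k2.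
  have l0 : 0 < l by lra.
  rewrite ltr_pdivrMr // mul1r in k1; rewrite ltr_pdivlMr // in k2.
  have kal : kappa * l <= 2 * k - l by rewrite /kappa in k2 *; lra.
  have kal0 : 0 < kappa * l by rewrite mulr_gt0.
  have KN : (K n.+1 < n.+1)%N by rewrite -(ltr_nat R).
  have N2K : (n.+1 < 2 * K n.+1)%N by rewrite -(ltr_nat R) natrM -/k -/l; lra.
  have K_gt1 : (1 < K n.+1)%N.
    by move: N4; rewrite /l ler_nat; lia.
  pose v := l ^+ 2 * ln l.
  have v0 : 0 < v by rewrite mulr_gt0 ?exprn_gt0 // ln_gt0; lra.
  pose t := 15 / kappa * v.
  have t0 : 0 <= t by rewrite mulr_ge0 // ltW.
  have d : fep_distance n.+1 (K n.+1) t <= eps.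
    apply: fep_distance_bound => //; first by lra.
    apply: le_trans (bound_asymptotics K_gt1 KN N2K ka0 kal (erefl t)) _.
    have ke0 : 0 < kappa * eps by apply: mulr_gt0; lra.
    rewrite ler_pdivrMr //; have -> : eps * (kappa * l) = l * (kappa * eps) by ring.
    by rewrite -ler_pdivrMr.
  have m : (fep_mixing_time n.+1 (K n.+1) eps <= t%:E)%E.
    by apply: ereal_inf_lbound; exists t.
  rewrite -/v; apply: (@le_trans _ _ (t%:E * (v^-1)%:E)%E).
    by apply: lee_wpmul2r => //; rewrite lee_fin invr_ge0 ltW.
  by rewrite -EFinM lee_fin /t mulfK // gt_eqF.
have key : \forall N \near \oo,
    (fep_mixing_time N (K N) eps * ((N%:R ^+ 2 * ln N%:R)^-1)%:E <= (15 / kappa)%:E)%E.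
  by near=> N; apply: main; near: N.
rewrite /limn_esup /limf_esup.
apply: (@le_trans _ _ (ereal_sup [set (fep_mixing_time N (K N) eps *
    ((N%:R ^+ 2 * ln N%:R)^-1)%:E)%E | N in [set N |
    (fep_mixing_time N (K N) eps * ((N%:R ^+ 2 * ln N%:R)^-1)%:E <= (15 / kappa)%:E)%E]])).
  by apply: ereal_inf_lbound; eexists; [exact: key|].
by apply: ge_ereal_sup => _ [N /= hN <-].
Unshelve. all: by end_near. Qed.
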